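(* Let $p,k\ge 1$ be integers, and let $\alpha_1,\dots,\alpha_{k+1},\gamma_1,\dots,\gamma_k\in\mathbb{C}$ satisfy $\Re(\alpha_j)>p-1$ for $j=1,\dots,k+1$, $\Re(\alpha_j+\gamma_j)>p-1$ for $j=1,\dots,k$, and $\Re(\alpha_{k+1}-\gamma_1-\cdots-\gamma_k)>p-1$. Let $E[\cdot]$ denote the average over the $p\times p$ complex matrix-variate type-2 Dirichlet measure with parameters $(\alpha_1,\dots,\alpha_k;\alpha_{k+1})$, and let $$\phi_4(\tilde X_1,\dots,\tilde X_k)=|\det(\tilde X_1)|^{\gamma_1}\cdots|\det(\tilde X_k)|^{\gamma_k}.$$ Then $$E[\phi_4]=\left\{\prod_{j=1}^k\frac{\tilde\Gamma_p(\alpha_j+\gamma_j)}{\tilde\Gamma_p(\alpha_j)}\right\}\frac{\tilde\Gamma_p(\alpha_{k+1}-\gamma_1-\cdots-\gamma_k)}{\tilde\Gamma_p(\alpha_{k+1})}.$$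
   Context: For Hermitian matrices, $A>O$ means $A$ is positive definite; $I$ is the $p\times p$ identity. For a $p\times p$ Hermitian matrix variable $\tilde X=(x_{ij}+\mathrm{i}\,y_{ij})$, $d\tilde X=\prod_{i\le j}dx_{ij}\prod_{i<j}dy_{ij}$ (Lebesgue measure in the independent real coordinates). $|\det(\cdot)|$ is the absolute value of the determinant. The complex matrix-variate gamma function is $\tilde\Gamma_p(\alpha)=\pi^{p(p-1)/2}\,\Gamma(\alpha)\Gamma(\alpha-1)\cdots\Gamma(\alpha-(p-1))$ for $\Re(\alpha)>p-1$. The complex matrix-variate type-2 Dirichlet measure with parameters $(\alpha_1,\dots,\alpha_k;\alpha_{k+1})$, $\Re(\alpha_j)>p-1$, has density $$f_2(\tilde X_1,\dots,\tilde X_k)=\tilde D_k\left(\prod_{j=1}^k|\det(\tilde X_j)|^{\alpha_j-p}\right)|\det(I+\tilde X_1+\cdots+\tilde X_k)|^{-(\alpha_1+\cdots+\alpha_{k+1})},\qquad \tilde D_k=\frac{\tilde\Gamma_p(\alpha_1+\cdots+\alpha_{k+1})}{\tilde\Gamma_p(\alpha_1)\cdots\tilde\Gamma_p(\alpha_{k+1})},$$ on the set of $k$-tuples of $p\times p$ Hermitian positive definite matrices $\tilde X_1,\dots,\tilde X_k$. The Dirichlet average of a function $\phi$ is $E[\phi]=\int\phi\,f_2\,d\tilde X_1\cdots d\tilde X_k$. *)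

(* Defs.v *)
From HB Require Import structures.
From mathcomp Require Import all_boot all_order all_algebra.
From mathcomp Require Import complex.
From mathcomp Require Import all_classical all_reals all_analysis.
From mathcomp Require Import lra.

Set Implicit Arguments.
Unset Strict Implicit.
Unset Printing Implicit Defensive.

Import Order.TTheory GRing.Theory Num.Theory.
Import numFieldNormedType.Exports.

Local Open Scope classical_set_scope.
Local Open Scope ring_scope.
Local Open Scope complex_scope.
Local Open Scope sesquilinear_scope.

Section power_measure.
Context {d : measure_display} {T : measurableType d} {R : realType}.

Definition tuple_cons n (x : T * n.-tuple T) : n.+1.-tuple T :=
  [tuple of x.1 :: x.2].

Definition tuple_uncons n (t : n.+1.-tuple T) : T * n.-tuple T :=
  (thead t, [tuple of behead t]).

Lemma tuple_consK n : cancel (@tuple_cons n) (@tuple_uncons n).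
Proof. by move=> [x t]; congr pair; exact/val_inj. Qed.

Lemma measurable_tuple_cons n : measurable_fun setT (@tuple_cons n).
Proof. exact: (@measurable_cons _ _ (T * n.-tuple T)%type T fst n snd). Qed.

Lemma measurable_tuple_uncons n : measurable_fun setT (@tuple_uncons n).
Proof.
apply: measurable_fun_pair; first exact: measurable_tnth.
exact: measurable_behead.
Qed.

Section cons_measure.
Variables (mu : {sigma_finite_measure set T -> \bar R}) (n : nat).
Variable nu : {sigma_finite_measure set (n.-tuple T) -> \bar R}.

Definition cons_measure : set (n.+1.-tuple T) -> \bar R :=
  pushforward (mu \x nu)%E (@tuple_cons n).

Let cons_measure0 : cons_measure set0 = 0%E.
Proof. by rewrite /cons_measure /pushforward preimage_set0 measure0. Qed.

Let cons_measure_ge0 A : (0 <= cons_measure A)%E.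
Proof. exact: (measure_ge0 (mu \x nu)%E). Qed.

Let cons_measure_sigma_additive : semi_sigma_additive cons_measure.
Proof.
have mp A : measurable A -> measurable (@tuple_cons n @^-1` A).
  by move=> mA; rewrite -[X in measurable X]setTI; exact: measurable_tuple_cons.
move=> F mF tF mUF; rewrite /cons_measure /pushforward preimage_bigcup.
apply: measure_semi_sigma_additive.
- by move=> i; exact: mp.
- apply/trivIsetP => /= i j _ _ ij; rewrite -preimage_setI.
  by move/trivIsetP : tF => /(_ _ _ _ _ ij) ->//; rewrite preimage_set0.
- by rewrite -preimage_bigcup; exact: mp.
Qed.

HB.instance Definition _ := isMeasure.Build _ _ _ cons_measure
  cons_measure0 cons_measure_ge0 cons_measure_sigma_additive.

Let cons_measure_sigma_finite : sigma_finite setT cons_measure.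
Proof.
have /sigma_finiteP[F [TF ndF Foo]] := sigma_finiteT mu.
have /sigma_finiteP[G [TG ndG Goo]] := sigma_finiteT nu.
exists (fun i => @tuple_uncons n @^-1` (F i `*` G i)).
  rewrite -preimage_bigcup (_ : \bigcup_i _ = setT) ?preimage_setT//.
  rewrite -subTset => -[x y] _.
  have [i _ Fx] : (\bigcup_i F i) x by rewrite -TF.
  have [j _ Gy] : (\bigcup_i G i) y by rewrite -TG.
  exists (maxn i j) => //; split.
    by move: x Fx; exact/subsetPset/ndF/leq_maxl.
  by move: y Gy; exact/subsetPset/ndG/leq_maxr.
move=> i; have [mF Fi] := Foo i; have [mG Gi] := Goo i; split.
  rewrite -[X in measurable X]setTI; apply: measurable_tuple_uncons => //.
  exact: measurableX.
rewrite /cons_measure /pushforward -comp_preimage.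
rewrite (_ : @tuple_uncons n \o @tuple_cons n = id); last first.
  by apply/funext => x; exact: tuple_consK.
by rewrite preimage_id product_measure1E// lte_mul_pinfty// ge0_fin_numE.
Qed.

HB.instance Definition _ := Measure_isSigmaFinite.Build _ _ _ cons_measure
  cons_measure_sigma_finite.

End cons_measure.

(* The product measure mu \x ... \x mu with n factors. *)
Fixpoint power_measure (mu : {sigma_finite_measure set T -> \bar R}) n :
    {sigma_finite_measure set (n.-tuple T) -> \bar R} :=
  if n is m.+1 then cons_measure mu (power_measure mu m) else \d_[tuple].

End power_measure.

Section complex_calculus.
Context {R : realType}.
Implicit Types z : R[i].

Definition cexp z : R[i] :=
  (expR (complex.Re z) * cos (complex.Im z)) +i*
  (expR (complex.Re z) * sin (complex.Im z)).

(* t ^ z for a real base t > 0; meaningless for t <= 0, where ln t = 0. *)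
Definition cpow (t : R) z : R[i] := cexp (z * (ln t)%:C).

Section cintegral.
Context {d : measure_display} {T : measurableType d}.
Variables (mu : {measure set T -> \bar R}) (D : set T) (f : T -> R[i]).

Definition cintegrable : Prop :=
  mu.-integrable D (fun x => (complex.Re (f x))%:E) /\
  mu.-integrable D (fun x => (complex.Im (f x))%:E).

(* Rintegral is a total function, so this only denotes the integral of f
   when cintegrable holds. *)
Definition cintegral : R[i] :=
  (\int[mu]_(x in D) complex.Re (f x)) +i*
  (\int[mu]_(x in D) complex.Im (f x)).

End cintegral.

(* Euler's integral: this is Gamma(z) for 0 < Re z only. *)
Definition cgamma z : R[i] :=
  cintegral lebesgue_measure `]0, +oo[
    (fun t : R => cpow t (z - 1) * (expR (- t))%:C).

(* For p - 1 < Re z, every factor has an argument with positive real part. *)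
Definition matrix_cgamma (p : nat) z : R[i] :=
  pi%:C ^+ (p * (p - 1))./2 * \prod_(j < p) cgamma (z - j%:R).

End complex_calculus.

Section hermitian_matrices.
Context {R : realType}.

(* A Hermitian matrix (x_ij + i y_ij) is given by its p * p independent real
   coordinates: the entry (i, j) of w is x_ij if i <= j, and y_ji if j < i. *)
Definition hermmx p (w : p.-tuple (p.-tuple R)) : 'M[R[i]]_p :=
  \matrix_(i, j)
    if (i < j)%N then tnth (tnth w i) j +i* tnth (tnth w j) i
    else if (j < i)%N then tnth (tnth w j) i -i* tnth (tnth w i) j
    else (tnth (tnth w i) i)%:C.

Lemma hermmx_hermsym p (w : p.-tuple (p.-tuple R)) : hermmx w \is hermsymmx.
Proof.
apply/is_hermitianmxP/matrixP => i j; rewrite expr0 scale1r !mxE.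
case: ltngtP => [_|_|/val_inj ->]; apply/eqP.
- by rewrite eq_complex /= opprK !eqxx.
- by rewrite eq_complex /= !eqxx.
- by rewrite eq_complex /= oppr0 !eqxx.
Qed.

Lemma hermmx_inj p : injective (@hermmx p).
Proof.
move=> w w' /matrixP ww'; apply: eq_from_tnth => i; apply: eq_from_tnth => j.
have [ij|ji|/val_inj <-] := ltngtP i j.
- by have /eqP := ww' i j; rewrite !mxE ij eq_complex /= => /andP[/eqP].
- by have /eqP := ww' j i; rewrite !mxE ji eq_complex /= => /andP[_ /eqP].
- by have /eqP := ww' i i; rewrite !mxE ltnn eq_complex /= => /andP[/eqP].
Qed.

Lemma hermmx_surj p (A : 'M[R[i]]_p) :
  A \is hermsymmx -> exists w, hermmx w = A.
Proof.
move=> /is_hermitianmxP; rewrite expr0 scale1r => /matrixP hA.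
have {}hA i j : A i j = (A j i)^*%C by rewrite {1}hA !mxE.
exists [tuple [tuple if (i <= j)%N then complex.Re (A i j)
                     else complex.Im (A j i) | j < p] | i < p].
apply/matrixP => i j; rewrite !mxE !tnth_mktuple.
case: ltngtP => [_|_|/val_inj <-].
- by case: (A i j).
- by rewrite (hA i j); case: (A j i).
- have := hA i i; case: (A i i) => u v [v0]; rewrite leqnn /=.
  by congr (_ +i* _); lra.
Qed.

Definition posdefmx p (A : 'M[R[i]]_p) : Prop :=
  A \is hermsymmx /\
  forall u : 'rV[R[i]]_p, u != 0 -> 0 < (u *m A *m u ^t*) 0 0.

(* |det A|; the norm of R[i] takes values in R[i]. *)
Definition absdet p (A : 'M[R[i]]_p) : R := complex.Re `|\det A|.

(* Lebesgue measure in the independent real coordinates. *)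
Definition hermmx_lebesgue p := power_measure (power_measure (@lebesgue_measure R) p) p.

End hermitian_matrices.

Section dirichlet2.
Context {R : realType} (p k : nat).
(* The parameters are (a_1, ..., a_k; b), that is, b is alpha_(k+1). *)
Variables (a : 'I_k -> R[i]) (b : R[i]).
Implicit Types X : 'I_k -> 'M[R[i]]_p.

Definition dirichlet2_const : R[i] :=
  matrix_cgamma p (\sum_j a j + b) /
  ((\prod_j matrix_cgamma p (a j)) * matrix_cgamma p b).

Definition dirichlet2_density X : R[i] :=
  dirichlet2_const * (\prod_j cpow (absdet (X j)) (a j - p%:R)) *
  cpow (absdet (1%:M + \sum_j X j)) (- (\sum_j a j + b)).

Local Notation coords := (k.-tuple (p.-tuple (p.-tuple R))).

Definition hermmx_family (w : coords) (j : 'I_k) : 'M[R[i]]_p :=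
  hermmx (tnth w j).

Definition dirichlet2_domain : set coords :=
  [set w | forall j, posdefmx (hermmx_family w j)].

Definition dirichlet2_average_exists (phi : ('I_k -> 'M[R[i]]_p) -> R[i]) :=
  cintegrable (power_measure (@hermmx_lebesgue R p) k) dirichlet2_domain
    (fun w => phi (hermmx_family w) * dirichlet2_density (hermmx_family w)).

Definition dirichlet2_average (phi : ('I_k -> 'M[R[i]]_p) -> R[i]) : R[i] :=
  cintegral (power_measure (@hermmx_lebesgue R p) k) dirichlet2_domain
    (fun w => phi (hermmx_family w) * dirichlet2_density (hermmx_family w)).

End dirichlet2.

Definition phi4 (R : realType) (p k : nat) (g : 'I_k -> R[i])
    (X : 'I_k -> 'M[R[i]]_p) : R[i] :=
  \prod_j cpow (absdet (X j)) (g j).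

(* Main.v *)
Require Import Defs.
From mathcomp Require Import all_boot all_order all_algebra.
From mathcomp Require Import complex.
From mathcomp Require Import all_classical all_reals all_analysis.
From mathcomp Require Import measurable_realfun ring lra.

Set Implicit Arguments.
Unset Strict Implicit.
Unset Printing Implicit Defensive.

Import Order.TTheory GRing.Theory Num.Theory.
Import numFieldNormedType.Exports.

Local Open Scope classical_set_scope.
Local Open Scope ring_scope.
Local Open Scope complex_scope.
Local Open Scope sesquilinear_scope.

(** Everything rests on the matrix-variate gamma integral, for A > 0,
      int_{X > 0} |det X|^(z - p) exp(- tr (A X)) dX = Gamma_p(z) |det A|^(- z).
    Let s be the sum of all parameters and put
      F(Z, Y) = |det Y|^(s - p) exp(- tr Y)
                * prod_j |det Z_j|^(a_j - p) exp(- tr (Y Z_j)).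
    Integrating over Y first gives Gamma_p(s) times the Dirichlet kernel, by the
    gamma integral with A = I + Z_1 + ... + Z_k; integrating over the Z_j first
    gives prod_j Gamma_p(a_j) times |det Y|^(b - p) exp(- tr Y), whose integral
    is Gamma_p(b).  As the normalizing constant contains Gamma_p(s), it is not
    necessary to know that Gamma_p(s) is nonzero.

    The gamma integral itself is obtained by splitting off the first row and
    column of X: with X = [x, v; v^*, S + x^-1 v^* v], the variables x, v, S
    separate after translations, the integral over v is Gaussian, and |det X|
    appears as x |det S|.  This is done for h(|det X|) with an arbitrary
    nonnegative h, so that only Tonelli's theorem is needed; complex powers are
    reached at the end by taking real and imaginary parts. *)

(** * Integration over powers of a measure *)

(** A congruence reducing A to the identity would call for its Jacobian on Hermitian matrices.
    Instead A is carried through the induction, and the only changes of variables are translations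
    of real coordinates and one dilation of the line. To keep the trace separable, A is factored
    from the corner opposite to that of X: A = U diag(s, D) U^*, where U is unitriangular with first
    row (1, y), D is the lower right block of A and s is its Schur complement. Then tr (A X) = s x +
    x^-1 (v + x y) D (v + x y)^* + tr (D S). The substitution t = s x leaves a gamma weight in t,
    and s and |det D| recombine into |det A|.

    Letting h vary is also what closes the induction: splitting off x replaces h by r |-> h (x r).

    Exchanging the integrals of the complex F requires absolute convergence. It comes out of the
    same computation, because |F| is F with every parameter replaced by its real part. *)

Section measurability.
Context {d d1 d2 d3 : measure_display} {X : measurableType d}
  {T : measurableType d1} {U : measurableType d2} {V : measurableType d3}.

Lemma measurable_fst_comp (f : X -> T * U) : measurable_fun setT f ->
  measurable_fun setT (fun x => (f x).1).
Proof. by move=> mf; exact: (measurableT_comp measurable_fst mf). Qed.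

Lemma measurable_snd_comp (f : X -> T * U) : measurable_fun setT f ->
  measurable_fun setT (fun x => (f x).2).
Proof. by move=> mf; exact: (measurableT_comp measurable_snd mf). Qed.

Lemma measurable_tnth_comp n (f : X -> n.-tuple T) (i : 'I_n) : measurable_fun setT f ->
  measurable_fun setT (fun x => tnth (f x) i).
Proof. by move=> mf; exact: (measurableT_comp (measurable_tnth i) mf). Qed.

Lemma measurable_mktuple n (f : 'I_n -> X -> T) :
  (forall i, measurable_fun setT (f i)) ->
  measurable_fun setT (fun x => [tuple f i x | i < n]).
Proof.
move=> mf; apply/measurable_fun_tnthP => i.
apply: (eq_measurable_fun (f i)) => [x _|]; last exact: mf.
by rewrite /= tnth_mktuple.
Qed.

Lemma measurable_tuple_cons_comp n (f : X -> T) (g : X -> n.-tuple T) :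
  measurable_fun setT f -> measurable_fun setT g ->
  measurable_fun setT (fun x => tuple_cons (f x, g x)).
Proof.
move=> mf mg; apply: (measurableT_comp (@measurable_tuple_cons _ T n)).
exact: measurable_fun_pair.
Qed.

End measurability.

Ltac meas1 :=
  match goal with
  | |- measurable_fun _ (fun x => tuple_cons (_, _)) => apply: measurable_tuple_cons_comp
  | |- measurable_fun _ (fun x => mktuple _) => apply: measurable_mktuple => ?
  | |- measurable_fun _ (fun x => tnth _ _) => apply: measurable_tnth_comp
  | |- measurable_fun _ (fun x => fst _) => apply: measurable_fst_comp
  | |- measurable_fun _ (fun x => snd _) => apply: measurable_snd_comp
  | |- measurable_fun _ (fun x => (_, _)) => apply: measurable_fun_pair
  | |- measurable_fun _ fst => exact: measurable_fst
  | |- measurable_fun _ snd => exact: measurable_snd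
  | |- measurable_fun _ (fun x => x) => exact: measurable_id
  | |- measurable_fun _ (fun x => _ x) => fail 1
  | |- measurable_fun _ (fun x => _) => exact: measurable_cst
  end.
Ltac meas := repeat meas1.

Section power_measure_integral.
Local Open Scope ereal_scope.
Context {d : measure_display} {T : measurableType d} {R : realType}.

Lemma ge0_integral_cons_measure (mu : {sigma_finite_measure set T -> \bar R}) n
    (nu : {sigma_finite_measure set (n.-tuple T) -> \bar R})
    (F : n.+1.-tuple T -> \bar R) :
  measurable_fun [set: n.+1.-tuple T] F -> (forall w, 0 <= F w) ->
  \int[cons_measure mu nu]_w F w =
  \int[mu]_x \int[nu]_t F (tuple_cons (x, t)).
Proof.
move=> mF F0; rewrite /cons_measure ge0_integral_pushforward//; last first.
  exact: measurable_tuple_cons.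
rewrite preimage_setT fubini_tonelli1//.
by apply: measurableT_comp => //; exact: measurable_tuple_cons.
by move=> x; exact: F0.
Qed.

Lemma ge0_integral_powerS (mu : {sigma_finite_measure set T -> \bar R}) n
    (F : n.+1.-tuple T -> \bar R) :
  measurable_fun [set: n.+1.-tuple T] F -> (forall w, 0 <= F w) ->
  \int[power_measure mu n.+1]_w F w =
  \int[mu]_x \int[power_measure mu n]_t F (tuple_cons (x, t)).
Proof. exact: ge0_integral_cons_measure. Qed.

Lemma integral_power0 (mu : {sigma_finite_measure set T -> \bar R})
    (F : 0.-tuple T -> \bar R) :
  \int[power_measure mu 0]_w F w = F [tuple].
Proof.
rewrite (_ : F = cst (F [tuple])).
  by rewrite integral_dirac// diracT mul1e.
by apply/funext => w; rewrite [w]tuple0.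
Qed.

End power_measure_integral.

(** * Splitting off the first column of a matrix *)

Section zipcons.
Context {d : measure_display} {T : measurableType d} {R : realType}.

Definition zipcons m n (a : n.-tuple T) (b : n.-tuple (m.-tuple T)) :
  n.-tuple (m.+1.-tuple T) := [tuple tuple_cons (tnth a i, tnth b i) | i < n].

Lemma zipcons_tuple_cons m n (a0 : T) (a : n.-tuple T) (b0 : m.-tuple T) b :
  zipcons (tuple_cons (a0, a)) (tuple_cons (b0, b)) =
  tuple_cons (tuple_cons (a0, b0), zipcons a b).
Proof.
apply: eq_from_tnth => i; rewrite tnth_mktuple.
case: (unliftP ord0 i) => [j|] ->; last by [].
by rewrite /tuple_cons/= !tnthS tnth_mktuple.
Qed.

Lemma measurable_zipcons m n d' (X : measurableType d')
  (f : X -> n.-tuple T) (g : X -> n.-tuple (m.-tuple T)) :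
  measurable_fun setT f -> measurable_fun setT g ->
  measurable_fun setT (fun x => zipcons (f x) (g x)).
Proof. by move=> mf mg; rewrite /zipcons; meas. Qed.

Local Open Scope ereal_scope.

Lemma measurable_integral_snd d1 d2 (X : measurableType d1)
    (Y : measurableType d2) (nu : {sigma_finite_measure set Y -> \bar R})
    (F : X -> Y -> \bar R) :
  measurable_fun setT (fun xy : X * Y => F xy.1 xy.2) ->
  (forall x y, 0 <= F x y) ->
  measurable_fun setT (fun x => \int[nu]_y F x y).
Proof.
move=> mF F0.
exact: (measurable_fun_fubini_tonelli_F (fun xy : X * Y => F xy.1 xy.2)).
Qed.

Lemma ge0_integral_swap d1 d2 (X : measurableType d1) (Y : measurableType d2)
    (mu : {sigma_finite_measure set X -> \bar R})
    (nu : {sigma_finite_measure set Y -> \bar R}) (F : X -> Y -> \bar R) :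
  measurable_fun setT (fun xy : X * Y => F xy.1 xy.2) ->
  (forall x y, 0 <= F x y) ->
  \int[mu]_x \int[nu]_y F x y = \int[nu]_y \int[mu]_x F x y.
Proof.
move=> mF F0.
exact: (fubini_tonelli (fun xy : X * Y => F xy.1 xy.2)).
Qed.

(* A matrix can be integrated by splitting off its first column. *)
Lemma ge0_integral_power_cons (mu : {sigma_finite_measure set T -> \bar R}) m
    (nu : {sigma_finite_measure set (m.-tuple T) -> \bar R}) n
    (F : n.-tuple (m.+1.-tuple T) -> \bar R) :
  measurable_fun setT F -> (forall w, 0 <= F w) ->
  \int[power_measure (cons_measure mu nu) n]_w F w =
  \int[power_measure mu n]_a \int[power_measure nu n]_b F (zipcons a b).
Proof.
elim: n F => [|n IH] F mF F0.
  by rewrite !integral_power0; congr F; rewrite [RHS]tuple0.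
rewrite ge0_integral_powerS//.
under eq_integral => r _.
  rewrite IH//; last by apply: measurableT_comp => //; meas.
  over.
rewrite ge0_integral_cons_measure//=; first last.
- by move=> w; apply: integral_ge0 => a _; apply: integral_ge0.
- apply: measurable_integral_snd; last by move=> *; apply: integral_ge0.
  apply: measurable_integral_snd => //.
  by apply: measurableT_comp => //; meas; apply: measurable_zipcons; meas.
rewrite ge0_integral_powerS//=; first last.
- by move=> w; apply: integral_ge0.
- apply: measurable_integral_snd => //.
  by apply: measurableT_comp => //; apply: measurable_zipcons; meas.
apply: eq_integral => a0 _.
(* With first row (a0, b0), the left side integrates in the order a0, b0, a, b and the right side in
   the order a0, a, b0, b. Only b0 and a have to be exchanged. *)
rewrite ge0_integral_swap; first last.
- by move=> *; apply: integral_ge0.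
- apply: measurable_integral_snd => //.
  by apply: measurableT_comp => //; meas; apply: measurable_zipcons; meas.
apply: eq_integral => a _.
rewrite ge0_integral_powerS//=; last first.
  by apply: measurableT_comp => //; apply: measurable_zipcons; meas.
by under [RHS]eq_integral do under eq_integral do rewrite zipcons_tuple_cons.
Qed.

(** Invariance is tested on nonnegative integrands rather than on sets: in this form it passes
    through iterated integrals, hence through [power_measure]. *)
Definition preserves (mu : set T -> \bar R) (phi : T -> T) :=
  measurable_fun setT phi /\
  forall F : T -> \bar R, measurable_fun setT F -> (forall x, 0 <= F x) ->
    \int[mu]_x F (phi x) = \int[mu]_x F x.

End zipcons.

(** * Coordinatewise maps on powers of a measure *)

Section preserves.
Local Open Scope ereal_scope.
Context {d : measure_display} {T : measurableType d} {R : realType}.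

Definition tuple_map_dep n (phi : 'I_n -> T -> T) (t : n.-tuple T) :=
  [tuple phi i (tnth t i) | i < n].

Lemma tuple_map_dep_cons n (phi : 'I_n.+1 -> T -> T) x (t : n.-tuple T) :
  tuple_map_dep phi (tuple_cons (x, t)) =
  tuple_cons (phi ord0 x, tuple_map_dep (fun i => phi (lift ord0 i)) t).
Proof.
apply: eq_from_tnth => i; rewrite tnth_mktuple.
case: (unliftP ord0 i) => [j|] ->; last by [].
by rewrite /tuple_cons/= !tnthS tnth_mktuple.
Qed.

(** The map may depend on the coordinate, so translations by arbitrary vectors are covered, and,
    after a second application, translations by arbitrary arrays. *)
Lemma preserves_power (mu : {sigma_finite_measure set T -> \bar R}) n
    (phi : 'I_n -> T -> T) :
  (forall i, preserves mu (phi i)) ->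
  preserves (power_measure mu n) (tuple_map_dep phi).
Proof.
elim: n phi => [|n IH] phi mphi.
  split=> [|F mF F0]; first by apply: measurable_mktuple => -[].
  by apply: eq_integral => x _; congr F; rewrite [LHS]tuple0 [RHS]tuple0.
have mp : measurable_fun setT (tuple_map_dep phi).
  apply: measurable_mktuple => i; apply: (measurableT_comp (proj1 (mphi i))).
  exact: measurable_tnth.
have [mt it] := IH (fun i => phi (lift ord0 i)) (fun i => mphi (lift ord0 i)).
split=> // F mF F0.
rewrite ge0_integral_powerS//; last exact: measurableT_comp.
rewrite ge0_integral_powerS//.
under eq_integral => x _.
  under eq_integral do rewrite tuple_map_dep_cons.
  rewrite (it (fun t => F (tuple_cons (phi ord0 x, t))))//.
    over.
  by apply: measurableT_comp => //; meas.
apply: (proj2 (mphi ord0) (fun x => \int[power_measure mu n]_t F (tuple_cons (x, t)))).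
- apply: measurable_integral_snd => //.
  by apply: measurableT_comp => //; meas.
- by move=> x; apply: integral_ge0.
Qed.

End preserves.

(** * Translations and dilations of the line *)

Section lebesgue_maps.
Local Open Scope ereal_scope.
Context {R : realType}.
Local Notation L := (@lebesgue_measure R).

Definition shift (c : R) : measurableTypeR R -> measurableTypeR R :=
  fun x => (x + c)%R.

Definition scale (c : R) : measurableTypeR R -> measurableTypeR R :=
  fun x => (c * x)%R.

Lemma measurable_shift c : measurable_fun setT (shift c).
Proof. by apply: measurable_funD => //; exact: measurable_cst. Qed.

Lemma measurable_scale c : measurable_fun setT (scale c).
Proof. by apply: measurable_funM => //; exact: measurable_cst. Qed.

(** The image measure gives each half-open interval its length, and this characterizes Lebesgue
    measure. *)
Lemma preserves_shift (c : R) : preserves L (shift c).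
Proof.
split=> [|F mF F0]; first exact: measurable_shift.
transitivity (\int[pushforward L (shift c)]_x F x).
  by rewrite ge0_integral_pushforward//; exact: measurable_shift.
pose m := measure_function_pushforward__canonical__measure_function_Measure
  L (measurable_shift c).
apply: (@eq_measure_integral _ _ _ setT L m) => A mA _.
refine (esym (@lebesgue_measure_unique R m _ A mA)).
move=> _ [[a b]] _ <-; rewrite /m/= /pushforward.
rewrite (_ : _ @^-1` _ = `](a - c)%R, (b - c)%R]%classic); last first.
  by apply/seteqP; split => x /=; rewrite !in_itv/= ltrBlDr lerBrDr.
rewrite !lebesgue_measure_itv/= !lte_fin ltrD2r.
by case: ifP => // _; rewrite -!EFinB; congr (_%:E); ring.
Qed.

(** The image measure under x |-> c x, multiplied by [c], gives half-open intervals their length;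
    the uniqueness of Lebesgue measure does the rest. *)
Lemma ge0_integral_scale (c : R) (F : measurableTypeR R -> \bar R) : (0 < c)%R ->
  measurable_fun setT F -> (forall x, 0 <= F x) ->
  \int[L]_x F (c * x)%R = (c^-1)%:E * \int[L]_x F x.
Proof.
move=> c0 mF F0.
have ci0 : (0 <= c)%R by exact: ltW.
have -> : \int[L]_x F x = c%:E * \int[L]_x F (scale c x); last first.
  by rewrite muleA -EFinM mulVf ?gt_eqF// mul1e.
transitivity (c%:E * \int[pushforward L (scale c)]_x F x); last first.
  by rewrite ge0_integral_pushforward//; exact: measurable_scale.
pose m := measure_function_pushforward__canonical__measure_function_Measure
  L (measurable_scale c).
rewrite -(@ge0_integral_mscale _ _ _ m setT measurableT (NngNum ci0) F)//.
apply: (@eq_measure_integral _ _ _ setT (mscale (NngNum ci0) m) L) => A mA _.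
refine (@lebesgue_measure_unique R (mscale (NngNum ci0) m) _ A mA).
move=> _ [[a b]] _ <-.
change (L `]a, b]%classic = c%:E * L (scale c @^-1` `]a, b]%classic)).
rewrite (_ : _ @^-1` _ = `](c^-1 * a)%R, (c^-1 * b)%R]%classic); last first.
  by apply/seteqP; split => x /=;
    rewrite !in_itv/= !(mulrC c^-1)%R ltr_pdivrMr// ler_pdivlMr// mulrC.
rewrite !lebesgue_measure_itv/= !lte_fin ltr_pM2l ?invr_gt0//.
case: ifPn => // _; rewrite ?mule0//.
by rewrite -!EFinB -EFinM -mulrBr mulrA divff ?gt_eqF// mul1r.
Qed.

End lebesgue_maps.

(** * Positive definite Hermitian matrices *)

Section posdef.
Context {R : realType}.
Local Notation C := R[i].

Lemma ctM m n q (A : 'M[C]_(m, n)) (B : 'M[C]_(n, q)) :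
  (A *m B)^t* = B^t* *m A^t*.
Proof. by rewrite trmx_mul map_mxM. Qed.

Lemma ctK m n (A : 'M[C]_(m, n)) : A^t*^t* = A.
Proof. by apply/matrixP => i j; rewrite !mxE conjCK. Qed.

Lemma ctD m n (A B : 'M[C]_(m, n)) : (A + B)^t* = A^t* + B^t*.
Proof. by rewrite linearD map_mxD. Qed.

Lemma ct0 m n : (0 : 'M[C]_(m, n))^t* = 0.
Proof. by apply/matrixP => i j; rewrite !mxE conjC0. Qed.

Lemma ct1 n : (1%:M : 'M[C]_n)^t* = 1%:M.
Proof. by rewrite trmx1 map_mx1. Qed.

Lemma conjC_real_complex (x : R) : (x%:C)^*%R = x%:C.
Proof. exact: conjc_real. Qed.

Lemma ctZ m n (x : R) (A : 'M[C]_(m, n)) : (x%:C *: A)^t* = x%:C *: A^t*.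
Proof.
by apply/matrixP => i j; rewrite !mxE rmorphM/= conjC_real_complex.
Qed.

Lemma ct_block m1 m2 n1 n2 (Aul : 'M[C]_(m1, n1)) (Aur : 'M[C]_(m1, n2))
  (Adl : 'M[C]_(m2, n1)) (Adr : 'M[C]_(m2, n2)) :
  (block_mx Aul Aur Adl Adr)^t* = block_mx (Aul^t*) (Adl^t*) (Aur^t*) (Adr^t*).
Proof. by rewrite tr_block_mx map_block_mx. Qed.

Lemma ct_row m n1 n2 (A : 'M[C]_(m, n1)) (B : 'M[C]_(m, n2)) :
  (row_mx A B)^t* = col_mx (A^t*) (B^t*).
Proof. by rewrite tr_row_mx map_col_mx. Qed.

Lemma hermsymmxE n (A : 'M[C]_n) : A \is hermsymmx <-> A^t* = A.
Proof.
split => [/is_hermitianmxP|hA]; last apply/is_hermitianmxP.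
  by rewrite expr0 scale1r => <-.
by rewrite expr0 scale1r hA.
Qed.

Lemma ct_sandwich m n (A : 'M[C]_n) (P : 'M[C]_(m, n)) : A^t* = A ->
  (P *m A *m P^t*)^t* = P *m A *m P^t*.
Proof. by move=> hA; rewrite !ctM ctK hA mulmxA. Qed.

Lemma ct11E (M : 'M[C]_1) : M^t* = M -> M = (complex.Re (M 0 0))%:C%:M.
Proof.
move=> /matrixP/(_ 0 0); rewrite !mxE => /CrealP/RRe_real ME.
by apply/matrixP => i j; rewrite !ord1 !mxE ME.
Qed.

Lemma ct_scalar11 (x : R) : (x%:C%:M : 'M[C]_1)^t* = x%:C%:M.
Proof. by apply/matrixP => i j; rewrite !ord1 !mxE conjC_real_complex. Qed.

Lemma ReZ (x : R) (z : C) : complex.Re (x%:C * z) = x * complex.Re z.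
Proof. by case: z => a b /=; ring. Qed.

Lemma ReD (z w : C) : complex.Re (z + w) = complex.Re z + complex.Re w.
Proof. by case: z w => [a b] [c e]. Qed.

(** Taking the real part gives a real-valued form for every matrix; for a Hermitian one no
    information is lost, by [quadE]. *)
Definition quad n (A : 'M[C]_n) (u : 'rV[C]_n) : R :=
  complex.Re ((u *m A *m u^t*) 0 0).

Lemma quadE n (A : 'M[C]_n) u : A^t* = A -> u *m A *m u^t* = (quad A u)%:C%:M.
Proof. by move=> hA; apply: ct11E; exact: ct_sandwich. Qed.

Lemma posdefmxP n (A : 'M[C]_n) :
  posdefmx A <-> A^t* = A /\ forall u, u != 0 -> 0 < quad A u.
Proof.
split=> -[]; [move=> /hermsymmxE hA pA | move=> hA pA]; split => //.
- by move=> u /pA; rewrite quadE// mxE eqxx ltcR.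
- exact/hermsymmxE.
- by move=> u /pA; rewrite quadE// mxE eqxx ltcR.
Qed.

Lemma posdefmx_ct n (A : 'M[C]_n) : posdefmx A -> A^t* = A.
Proof. by move=> /posdefmxP[]. Qed.

(** The form would vanish on a nonzero row of the kernel. *)
Lemma posdefmx_unit n (A : 'M[C]_n) : posdefmx A -> A \in unitmx.
Proof.
move=> /posdefmxP[_ pA]; rewrite -row_free_unit -kermx_eq0.
apply/eqP/row_matrixP => i; rewrite row0; apply/eqP/negPn/negP => u0.
have := pA _ u0; have /sub_kermxP uA0 := row_sub i (kermx A).
by rewrite /quad uA0 mul0mx mxE ltxx.
Qed.

Lemma posdefmx1 n : posdefmx (1%:M : 'M[C]_n).
Proof.
split=> [|u u0]; first exact/hermsymmxE/ct1.
rewrite mulmx1 mxE lt_neqAle sumr_ge0 => [|j _]; last first.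
  by rewrite !mxE mul_conjC_ge0.
rewrite andbT eq_sym psumr_eq0 => [|j _]; last by rewrite !mxE mul_conjC_ge0.
apply: contra_neqN u0 => /allP uj; apply/rowP => j; rewrite mxE.
have := uj j (mem_index_enum j).
by rewrite !mxE mul_conjC_eq0 => /eqP.
Qed.

Lemma quadD n (A B : 'M[C]_n) u : quad (A + B) u = quad A u + quad B u.
Proof. by rewrite /quad mulmxDr mulmxDl mxE raddfD. Qed.

Lemma quadZ n (x : R) (A : 'M[C]_n) u : quad (x%:C *: A) u = x * quad A u.
Proof.
by rewrite /quad -scalemxAr -scalemxAl mxE ReZ.
Qed.

Lemma posdefmxD n (A B : 'M[C]_n) : posdefmx A -> posdefmx B -> posdefmx (A + B).
Proof.
move=> /posdefmxP[hA pA] /posdefmxP[hB pB]; apply/posdefmxP; split.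
  by rewrite ctD hA hB.
by move=> u u0; rewrite quadD addr_gt0 ?pA ?pB.
Qed.

Lemma posdefmxZ n (x : R) (A : 'M[C]_n) : 0 < x -> posdefmx A ->
  posdefmx (x%:C *: A).
Proof.
move=> x0 /posdefmxP[hA pA]; apply/posdefmxP; split; first by rewrite ctZ hA.
by move=> u u0; rewrite quadZ mulr_gt0 ?pA.
Qed.

Lemma quad_congr n (A P : 'M[C]_n) u : quad (P *m A *m P^t*) u = quad A (u *m P).
Proof. by rewrite /quad ctM !mulmxA. Qed.

Lemma quad_diag n (x : R) (D : 'M[C]_n) (a : 'M[C]_1) (b : 'rV[C]_n) :
  quad (block_mx (x%:C%:M : 'M[C]_1) 0 0 D) (row_mx a b) =
  x * complex.Re (a 0 0 * (a 0 0)^*%R) + quad D b.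
Proof.
rewrite /quad mul_row_block ct_row mul_row_col !mulmx0 addr0 add0r mxE raddfD/=.
by rewrite mul_mx_scalar !mxE big_ord1 !mxE -mulrA ReZ.
Qed.

Lemma posdefmx_congr n (A P : 'M[C]_n) : P \in unitmx ->
  posdefmx (P *m A *m P^t*) <-> posdefmx A.
Proof.
have cong (B Q : 'M[C]_n) : Q \in unitmx -> posdefmx B -> posdefmx (Q *m B *m Q^t*).
  move=> uQ /posdefmxP[hB pB]; apply/posdefmxP; split; first exact: ct_sandwich.
  move=> u u0; rewrite /quad !mulmxA -[_ *m Q^t* *m _]mulmxA -ctM; apply: pB.
  by apply: contra_neq u0 => uQ0; rewrite -(mulmxK uQ u) uQ0 mul0mx.
move=> uP; split; last exact: cong.
move=> /(@cong _ (invmx P)); rewrite unitmx_inv => /(_ uP).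
by rewrite !mulmxA mulVmx// mul1mx -mulmxA -ctM mulVmx// ct1 mulmx1.
Qed.

Lemma posdefmx_diag n (x : R) (D : 'M[C]_n) :
  posdefmx (block_mx (x%:C%:M : 'M[C]_1) 0 0 D) <-> 0 < x /\ posdefmx D.
Proof.
split=> [/posdefmxP[]|[x0 /posdefmxP[hD pD]]].
  rewrite ct_block => /(@eq_block_mx _ _ _ _ _)[_ _ _ hD] pD.
  split.
    have := pD (row_mx 1%:M 0); rewrite quad_diag /quad !mul0mx !mxE eqxx.
    rewrite conjC1 mulr1 mulr1 addr0; apply.
    by apply/eqP => /matrixP/(_ 0 (lshift _ 0)); rewrite row_mxEl !mxE => /eqP;
      rewrite oner_eq0.
  apply/posdefmxP; split=> // u u0.
  have := pD (row_mx 0 u); rewrite quad_diag mxE mul0r mulr0 add0r; apply.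
  by apply: contra_neq u0; rewrite -row_mx0 => /eq_row_mx[].
apply/posdefmxP; split; first by rewrite ct_block ct_scalar11 !ct0 hD.
move=> u; rewrite -[u]hsubmxK quad_diag => u0.
set a := lsubmx u 0 0; set b := rsubmx u.
have aE : a * a^*%R = (complex.Re (a * a^*%R))%:C.
  by rewrite RRe_real// ger0_real// mul_conjC_ge0.
have a0 : 0 <= complex.Re (a * a^*%R).
  by rewrite -ler0c -aE mul_conjC_ge0.
have [b0|b0] := eqVneq b 0; last first.
  by rewrite ltr_wpDl ?pD// mulr_ge0// ltW.
rewrite b0 /quad !mul0mx mxE addr0 mulr_gt0// lt_neqAle a0 andbT eq_sym.
apply/eqP => aa0; move: aE; rewrite aa0 => /eqP; rewrite mul_conjC_eq0 => /eqP a00.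
by move: u0; rewrite -/b b0 [lsubmx u]mx11_scalar -/a a00 raddf0 row_mx0 eqxx.
Qed.

Lemma absdetM n (A B : 'M[C]_n) : absdet (A *m B) = absdet A * absdet B.
Proof. by rewrite /absdet det_mulmx normrM !normc_def /=; ring. Qed.

Lemma absdet_ct n (A : 'M[C]_n) : absdet (A^t*) = absdet A.
Proof. by rewrite /absdet det_map_mx det_tr norm_conjC. Qed.

Lemma absdetZ n (x : R) (A : 'M[C]_n) : 0 <= x ->
  absdet (x%:C *: A) = x ^+ n * absdet A.
Proof.
move=> x0; rewrite /absdet detZ normrM normrX ger0_norm ?ler0c// normc_def -rmorphXn/=.
by ring.
Qed.

Lemma absdet_gt0 n (A : 'M[C]_n) : posdefmx A -> 0 < absdet A.
Proof.
move=> /posdefmx_unit; rewrite unitmxE unitfE -normr_gt0.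
by rewrite /absdet normc_def ltcR.
Qed.

Lemma absdet_diag n (x : R) (D : 'M[C]_n) : 0 < x ->
  absdet (block_mx (x%:C%:M : 'M[C]_1) 0 0 D) = x * absdet D.
Proof.
move=> x0; rewrite /absdet det_lblock det_scalar1 normrM.
by rewrite ger0_norm ?ler0c ?ltW// normc_def/=; ring.
Qed.

(** * Triangular factorizations and Schur complements *)

Section unitriangular.
Context {n : nat}.
Implicit Types (y : 'rV[C]_n) (D : 'M[C]_n).

(** The two kinds of factor serve opposite corners: [upper1] reduces the parameter of the
    exponential, keeping its lower right block, while [lower1] reduces the integration variable,
    keeping its upper left entry. *)
Definition upper1 y : 'M[C]_(1 + n) := block_mx 1%:M y 0 1%:M.
Definition lower1 (z : 'cV[C]_n) : 'M[C]_(1 + n) := block_mx 1%:M 0 z 1%:M.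

Lemma unit_upper1 y : upper1 y \in unitmx.
Proof. by rewrite unitmxE det_ublock !det1 mulr1 unitr1. Qed.

Lemma unit_lower1 z : lower1 z \in unitmx.
Proof. by rewrite unitmxE det_lblock !det1 mulr1 unitr1. Qed.

Lemma absdet_upper1 y : absdet (upper1 y) = 1.
Proof. by rewrite /absdet det_ublock !det1 mulr1 normr1. Qed.

Lemma absdet_lower1 z : absdet (lower1 z) = 1.
Proof. by rewrite /absdet det_lblock !det1 mulr1 normr1. Qed.

Lemma upper1_sandwich y (x : 'M[C]_1) D :
  upper1 y *m block_mx x 0 0 D *m (upper1 y)^t* =
  block_mx (x + y *m D *m y^t*) (y *m D) (D *m y^t*) D.
Proof.
rewrite ct_block !ct1 ct0 !mulmx_block.
by rewrite !(mulmx0, mul0mx, mulmx1, mul1mx, addr0, add0r).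
Qed.

Lemma lower1_sandwich z (x : R) D :
  lower1 z *m block_mx (x%:C%:M : 'M[C]_1) 0 0 D *m (lower1 z)^t* =
  block_mx (x%:C%:M) (x%:C *: z^t*) (x%:C *: z) (D + x%:C *: (z *m z^t*)).
Proof.
rewrite ct_block !ct1 ct0 !mulmx_block.
rewrite !(mulmx0, mul0mx, mulmx1, mul1mx, addr0, add0r).
by rewrite mul_mx_scalar mul_scalar_mx -scalemxAl addrC.
Qed.

Lemma posdefmx_upper1P (A : 'M[C]_(1 + n)) : posdefmx A ->
  exists (s : R) y D, [/\ 0 < s, posdefmx D, absdet A = s * absdet D &
    A = upper1 y *m block_mx (s%:C%:M : 'M[C]_1) 0 0 D *m (upper1 y)^t*].
Proof.
move=> pA; have hA := posdefmx_ct pA.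
have hdr : (drsubmx A)^t* = drsubmx A by rewrite trmx_drsub map_drsubmx hA.
have hul : (ulsubmx A)^t* = ulsubmx A by rewrite trmx_ulsub map_ulsubmx hA.
have hur : (ursubmx A)^t* = dlsubmx A by rewrite trmx_ursub map_dlsubmx hA.
have pD : posdefmx (drsubmx A).
  apply/posdefmxP; split=> // u u0.
  have /posdefmxP[_ /(_ (row_mx 0 u))] := pA.
  rewrite /quad (_ : row_mx 0 u *m A = row_mx (u *m dlsubmx A) (u *m drsubmx A)); last first.
    by rewrite -{1}[A]submxK mul_row_block !mul0mx !add0r.
  rewrite ct_row mul_row_col ct0 mulmx0 add0r; apply.
  by apply: contra_neq u0; rewrite -row_mx0 => /eq_row_mx[_].
have uD := posdefmx_unit pD; set D := drsubmx A in pD uD.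
pose y := ursubmx A *m invmx D.
(* [M] is the Schur complement of the lower right block. Being Hermitian of size 1, it is a real
   scalar [s], whose positivity comes from the congruence of [A] with diag(s, D). *)
pose M := ulsubmx A - y *m D *m y^t*.
have /ct11E ME : M^t* = M.
  by rewrite /M linearB/= map_mxB ct_sandwich ?(posdefmx_ct pD)// hul.
set s := complex.Re (M 0 0) in ME.
have AE : A = upper1 y *m block_mx (s%:C%:M : 'M[C]_1) 0 0 D *m (upper1 y)^t*.
  rewrite upper1_sandwich -ME /M subrK /y mulmxKV// ctM mulmxA.
  have -> : D *m (invmx D)^t* = 1%:M.
    by rewrite -{1}(posdefmx_ct pD) -ctM mulVmx// ct1.
  rewrite mul1mx.
  by rewrite hur [RHS]submxK.
clear ME; clearbody s; clear M; clearbody y D.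
have /posdefmx_diag[s0 _] : posdefmx (block_mx (s%:C%:M : 'M[C]_1) 0 0 D).
  apply: (posdefmx_congr _ (unit_upper1 y)).1.
  by move: pA; rewrite AE.
exists s, y, D; split => //.
by rewrite AE 2!absdetM absdet_ct absdet_upper1 absdet_diag// mul1r mulr1.
Qed.

(** The lower right block is parametrized by its Schur complement [S], so that by congruence both
    positivity and determinant depend on [x] and [S] alone. *)
Lemma schur_sandwich (x : R) (v : 'rV[C]_n) (S : 'M[C]_n) : x != 0 ->
  block_mx (x%:C%:M : 'M[C]_1) v (v^t*) (S + x^-1%:C *: (v^t* *m v)) =
  lower1 (x^-1%:C *: v^t*) *m block_mx (x%:C%:M : 'M[C]_1) 0 0 S *m
    (lower1 (x^-1%:C *: v^t*))^t*.
Proof.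
move=> x0.
have xx : x%:C * x^-1%:C = 1 :> C.
  by apply/eqP; rewrite eq_complex/= !(mulr0, mul0r, subr0, addr0) divff// !eqxx.
rewrite lower1_sandwich ctZ ctK !scalerA xx !scale1r.
congr block_mx; rewrite -scalemxAl -scalemxAr !scalerA.
by rewrite xx mul1r.
Qed.

Lemma posdefmx_schur (x : R) (v : 'rV[C]_n) (S : 'M[C]_n) : x != 0 ->
  posdefmx (block_mx (x%:C%:M : 'M[C]_1) v (v^t*) (S + x^-1%:C *: (v^t* *m v))) <->
  0 < x /\ posdefmx S.
Proof.
move=> x0; rewrite schur_sandwich// posdefmx_congr ?unit_lower1//.
exact: posdefmx_diag.
Qed.

(** Positivity of the corner has to be known beforehand, because the parametrization by [S]
    presupposes [x != 0]. *)
Lemma posdefmx_block_gt0 (x : R) (v : 'rV[C]_n) D :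
  posdefmx (block_mx (x%:C%:M : 'M[C]_1) v (v^t*) D) -> 0 < x.
Proof.
move=> /posdefmxP[_ /(_ (row_mx 1%:M 0))].
rewrite /quad mul_row_block ct_row mul_row_col ct0 mulmx0 addr0 mul0mx addr0.
rewrite ct1 mul1mx mulmx1 mxE eqxx; apply.
by apply/eqP => /matrixP/(_ 0 (lshift _ 0)); rewrite row_mxEl !mxE => /eqP;
      rewrite oner_eq0.
Qed.

Lemma absdet_schur (x : R) (v : 'rV[C]_n) (S : 'M[C]_n) : 0 < x ->
  absdet (block_mx (x%:C%:M : 'M[C]_1) v (v^t*) (S + x^-1%:C *: (v^t* *m v))) =
  x * absdet S.
Proof.
move=> x0; rewrite schur_sandwich ?gt_eqF// 2!absdetM absdet_ct absdet_lower1.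
by rewrite absdet_diag// mul1r mulr1.
Qed.

(** In the Gaussian integral, the first complex coordinate acts on the others only through a
    translation along [y]. *)
Lemma quad_upper1 (s : R) y D (a1 a2 : R) (b : 'rV[C]_n) :
  quad (upper1 y *m block_mx (s%:C%:M : 'M[C]_1) 0 0 D *m (upper1 y)^t*)
    (row_mx ((a1 +i* a2)%:M : 'M[C]_1) b) =
  s * (a1 ^+ 2 + a2 ^+ 2) + quad D (b + (a1 +i* a2) *: y).
Proof.
rewrite quad_congr mul_row_block !mulmx0 !mulmx1 addr0 quad_diag mxE eqxx/=.
rewrite mul_scalar_mx [X in quad D X]addrC.
by congr (_ + _); ring.
Qed.

(** The real part serves only to land in [R]: the trace of a product of two Hermitian matrices is
    real. *)
Definition rtrace m (A B : 'M[C]_m) : R := complex.Re (\tr (A *m B)).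

Lemma quad_tr m (A : 'M[C]_m) u : quad A u = complex.Re (\tr (u *m A *m u^t*)).
Proof. by rewrite /quad /mxtrace big_ord1. Qed.

(** The square in [v] is completed: the cross terms and the part y D y^* of the corner of the first
    factor are absorbed by the square, and [x] keeps the coefficient [s]. *)
Lemma rtrace_schur (s x : R) y D (v : 'rV[C]_n) (S : 'M[C]_n) : x != 0 ->
  rtrace (upper1 y *m block_mx (s%:C%:M : 'M[C]_1) 0 0 D *m (upper1 y)^t*)
   (block_mx (x%:C%:M : 'M[C]_1) v (v^t*) (S + x^-1%:C *: (v^t* *m v))) =
  s * x + x^-1 * quad D (v + x%:C *: y) + rtrace D S.
Proof.
move=> x0; rewrite upper1_sandwich /rtrace mulmx_block mxtrace_block.
rewrite quad_tr ctD ctZ !(mulmxDl, mulmxDr, mxtraceD).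
rewrite !mul_mx_scalar; do 4! rewrite -?scalemxAl -?scalemxAr.
rewrite !mxtraceZ mxtrace_scalar mulr1n.
rewrite (mxtrace_mulC (D *m y^t*) v) (mxtrace_mulC D (v^t* *m v)).
rewrite -(mulmxA (v^t*) v D) (mxtrace_mulC (v^t*) (v *m D)) !mulmxA.
rewrite !(ReD, ReZ) (_ : complex.Re s%:C = s)//.
have key (a1 a2 a3 a4 a5 : R) : x * s + x * a1 + a2 + (a3 + (a5 + x^-1 * a4)) =
    s * x + x^-1 * (a4 + x * a2 + (x * a3 + x * (x * a1))) + a5 by field.
exact: key.
Qed.

End unitriangular.

End posdef.

(** * Measurability of complex and matrix-valued functions *)

Section cmeasurable.
Context {d : measure_display} {X : measurableType d} {R : realType}.
Local Notation C := R[i].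
Implicit Types f g : X -> C.

(** Componentwise, to match [cintegrable] and [cintegral]. *)
Definition cmeasurable f :=
  measurable_fun setT (fun x => complex.Re (f x)) /\
  measurable_fun setT (fun x => complex.Im (f x)).

Lemma cmeasurable_cst (c : C) : cmeasurable (fun=> c).
Proof. by split; exact: measurable_cst. Qed.

Lemma cmeasurable_real (h : X -> R) : measurable_fun setT h ->
  cmeasurable (fun x => (h x)%:C).
Proof. by move=> mh; split => //; exact: measurable_cst. Qed.

Lemma cmeasurable_pair (h k : X -> R) : measurable_fun setT h ->
  measurable_fun setT k -> cmeasurable (fun x => h x +i* k x).
Proof. by []. Qed.

Lemma cmeasurableD f g : cmeasurable f -> cmeasurable g ->
  cmeasurable (fun x => f x + g x).
Proof.
move=> [f1 f2] [g1 g2]; split.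
- rewrite (_ : (fun _ => _) = fun x => complex.Re (f x) + complex.Re (g x)).
    exact: measurable_funD.
  by apply/funext => x; case: (f x) => ? ?; case: (g x).
- rewrite (_ : (fun _ => _) = fun x => complex.Im (f x) + complex.Im (g x)).
    exact: measurable_funD.
  by apply/funext => x; case: (f x) => ? ?; case: (g x).
Qed.

Lemma cmeasurableM f g : cmeasurable f -> cmeasurable g ->
  cmeasurable (fun x => f x * g x).
Proof.
move=> [f1 f2] [g1 g2]; split.
- rewrite (_ : (fun _ => _) = fun x => complex.Re (f x) * complex.Re (g x) -
      complex.Im (f x) * complex.Im (g x)).
    by apply: measurable_funB; exact: measurable_funM.
  by apply/funext => x; case: (f x) => ? ?; case: (g x).
- rewrite (_ : (fun _ => _) = fun x => complex.Re (f x) * complex.Im (g x) +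
      complex.Im (f x) * complex.Re (g x)).
    by apply: measurable_funD; exact: measurable_funM.
  by apply/funext => x; case: (f x) => ? ?; case: (g x).
Qed.

Lemma cmeasurable_conj f : cmeasurable f -> cmeasurable (fun x => (f x)^*%R).
Proof.
move=> [f1 f2]; split.
- rewrite (_ : (fun _ => _) = fun x => complex.Re (f x))//.
  by apply/funext => x; case: (f x).
- rewrite (_ : (fun _ => _) = fun x => - complex.Im (f x)).
    exact: measurable_funN.
  by apply/funext => x; case: (f x).
Qed.

Lemma cmeasurable_sum I (s : seq I) (F : I -> X -> C) :
  (forall i, cmeasurable (F i)) -> cmeasurable (fun x => \sum_(i <- s) F i x).
Proof.
move=> mF; elim: s => [|i s IH].
  by under eq_fun do rewrite big_nil; exact: cmeasurable_cst.
by under eq_fun do rewrite big_cons; exact: cmeasurableD.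
Qed.

Lemma cmeasurable_prod I (s : seq I) (F : I -> X -> C) :
  (forall i, cmeasurable (F i)) -> cmeasurable (fun x => \prod_(i <- s) F i x).
Proof.
move=> mF; elim: s => [|i s IH].
  by under eq_fun do rewrite big_nil; exact: cmeasurable_cst.
by under eq_fun do rewrite big_cons; exact: cmeasurableM.
Qed.

Definition mxmeasurable m n (A : X -> 'M[C]_(m, n)) :=
  forall i j, cmeasurable (fun x => A x i j).

Lemma mxmeasurable_mul m n q (A : X -> 'M[C]_(m, n)) (B : X -> 'M[C]_(n, q)) :
  mxmeasurable A -> mxmeasurable B -> mxmeasurable (fun x => A x *m B x).
Proof.
move=> mA mB i j; under eq_fun do rewrite mxE.
by apply: cmeasurable_sum => k; exact: cmeasurableM.
Qed.

Lemma mxmeasurable_cst m n (A : 'M[C]_(m, n)) : mxmeasurable (fun=> A).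
Proof. by move=> i j; exact: cmeasurable_cst. Qed.

Lemma mxmeasurableD m n (A B : X -> 'M[C]_(m, n)) :
  mxmeasurable A -> mxmeasurable B -> mxmeasurable (fun x => A x + B x).
Proof.
by move=> mA mB i j; under eq_fun do rewrite mxE; exact: cmeasurableD.
Qed.

Lemma mxmeasurableZ m n (c : X -> C) (A : X -> 'M[C]_(m, n)) :
  cmeasurable c -> mxmeasurable A -> mxmeasurable (fun x => c x *: A x).
Proof.
by move=> mc mA i j; under eq_fun do rewrite mxE; exact: cmeasurableM.
Qed.

Lemma mxmeasurable_ct m n (A : X -> 'M[C]_(m, n)) :
  mxmeasurable A -> mxmeasurable (fun x => (A x)^t*).
Proof.
by move=> mA i j; under eq_fun do rewrite !mxE; exact: cmeasurable_conj.
Qed.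

Lemma cmeasurable_tr n (A : X -> 'M[C]_n) :
  mxmeasurable A -> cmeasurable (fun x => \tr (A x)).
Proof. by move=> mA; apply: cmeasurable_sum => i; exact: mA. Qed.

Lemma cmeasurable_det n (A : X -> 'M[C]_n) :
  mxmeasurable A -> cmeasurable (fun x => \det (A x)).
Proof.
move=> mA; apply: cmeasurable_sum => s; apply: cmeasurableM.
  exact: cmeasurable_cst.
by apply: cmeasurable_prod => i; exact: mA.
Qed.

Lemma measurable_Re_norm f : cmeasurable f ->
  measurable_fun setT (fun x => complex.Re `|f x|).
Proof.
move=> [f1 f2].
rewrite (_ : (fun _ => _) =
    Num.sqrt \o (fun x => complex.Re (f x) ^+ 2 + complex.Im (f x) ^+ 2)).
  apply: measurableT_comp.
    apply: continuous_measurable_fun; exact: sqrt_continuous.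
  by apply: measurable_funD; exact: measurable_funX.
by apply/funext => x; rewrite normc_def.
Qed.

Lemma measurable_absdet n (A : X -> 'M[C]_n) :
  mxmeasurable A -> measurable_fun setT (fun x => absdet (A x)).
Proof. by move=> mA; exact/measurable_Re_norm/cmeasurable_det. Qed.

Lemma measurable_quad n (A : X -> 'M[C]_n) (u : X -> 'rV[C]_n) :
  mxmeasurable A -> mxmeasurable u -> measurable_fun setT (fun x => quad (A x) (u x)).
Proof.
move=> mA mu; apply: (proj1 (_ : cmeasurable _)).
apply: mxmeasurable_mul; last exact: mxmeasurable_ct.
exact: mxmeasurable_mul.
Qed.

Lemma measurable_rtrace n (A B : X -> 'M[C]_n) :
  mxmeasurable A -> mxmeasurable B -> measurable_fun setT (fun x => rtrace (A x) (B x)).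
Proof.
by move=> mA mB; exact: (proj1 (cmeasurable_tr (mxmeasurable_mul mA mB))).
Qed.

Lemma cmeasurable_cexp f : cmeasurable f -> cmeasurable (fun x => cexp (f x)).
Proof.
move=> [f1 f2]; apply: cmeasurable_pair; apply: measurable_funM.
- exact: (measurableT_comp (@measurable_expR R)).
- apply: (measurableT_comp _ f2); apply: continuous_measurable_fun.
  exact: continuous_cos.
- exact: (measurableT_comp (@measurable_expR R)).
- apply: (measurableT_comp _ f2); apply: continuous_measurable_fun.
  exact: continuous_sin.
Qed.

Lemma cmeasurable_cpow (h : X -> R) (z : C) : measurable_fun setT h ->
  cmeasurable (fun x => cpow (h x) z).
Proof.
move=> mh; apply: cmeasurable_cexp; apply: cmeasurableM.
  exact: cmeasurable_cst.
by apply: cmeasurable_real; exact: (measurableT_comp (@measurable_ln R)).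
Qed.

Lemma mxmeasurable_hermmx p (f : X -> p.-tuple (p.-tuple (measurableTypeR R))) :
  measurable_fun setT f -> mxmeasurable (fun x => hermmx (f x) : 'M[C]_p).
Proof.
move=> mf i j; under eq_fun do rewrite mxE.
have mt i' j' : measurable_fun setT (fun x => tnth (tnth (f x) i') j' : R).
  by do 2 apply: measurable_tnth_comp.
case: ltngtP => _.
- by apply: cmeasurable_pair.
- by apply: cmeasurable_pair => //; exact: measurable_funN.
- exact: cmeasurable_real.
Qed.

End cmeasurable.

(** * Integration over Hermitian matrices *)

Section pack.
Context {R : realType}.
Local Notation C := R[i].
Local Notation T := (measurableTypeR R).

(** By the coordinate convention of [hermmx], the real parts of the first row of the matrix lie in
    the first row of the array, and their imaginary parts in its first column. *)
Definition pack n (x : T) (vr vi : n.-tuple T) (w : n.-tuple (n.-tuple T)) :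
    n.+1.-tuple (n.+1.-tuple T) :=
  tuple_cons (tuple_cons (x, vr), zipcons vi w).

Definition cvec n (vr vi : n.-tuple T) : 'rV[C]_n :=
  \row_j (tnth vr j +i* tnth vi j).

Lemma hermmx_pack n x (vr vi : n.-tuple T) w :
  hermmx (pack x vr vi w) =
  block_mx (x%:C%:M : 'M[C]_1) (cvec vr vi) ((cvec vr vi)^t*) (hermmx w)
  :> 'M[C]_(1 + n).
Proof.
have l0 : (ord0 : 'I_n.+1) = lshift n (ord0 : 'I_1) by exact: val_inj.
have lS i : lift (ord0 : 'I_n.+1) i = rshift 1 i by exact: val_inj.
have p0S j : tnth (tnth (pack x vr vi w) ord0) (lift ord0 j) = tnth vr j.
  by rewrite /pack/= [LHS]tnthS; congr tnth; exact: val_inj.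
have pS i : tnth (pack x vr vi w) (lift ord0 i) = tuple_cons (tnth vi i, tnth w i).
  by rewrite /pack tnthS tnth_mktuple.
have pSS i j : tnth (tuple_cons (tnth vi i, tnth w i)) (lift ord0 j) = tnth (tnth w i) j.
  by rewrite /tuple_cons tnthS; congr tnth; exact: val_inj.
apply/matrixP => i j; rewrite [LHS]mxE.
case: (unliftP (ord0 : 'I_n.+1) i) => [i'|] ->;
  case: (unliftP (ord0 : 'I_n.+1) j) => [j'|] ->.
- rewrite [in RHS]lS [in RHS](lS j') block_mxEdr mxE !lift0 !ltnS !pS !pSS.
  by case: ltngtP.
- by rewrite [in RHS]lS [in RHS]l0 block_mxEdl !mxE/= p0S pS.
- by rewrite [in RHS]lS [in RHS]l0 block_mxEur !mxE/= p0S pS.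
- by rewrite ltnn [in RHS]l0 block_mxEul !mxE eqxx.
Qed.

(* The inverse of [hermmx], entrywise. *)
Definition hermcoord n (H : 'M[C]_n) (i j : 'I_n) : R :=
  if (i <= j)%N then complex.Re (H i j) else complex.Im (H j i).

(** Addition of a Hermitian matrix, written as a translation of each real coordinate, which leaves
    [hermmx_lebesgue] invariant. *)
Definition hermshift n (H : 'M[C]_n) : n.-tuple (n.-tuple T) -> n.-tuple (n.-tuple T) :=
  tuple_map_dep (fun i => tuple_map_dep (fun j => shift (hermcoord H i j))).

Lemma hermmx_shift n (H : 'M[C]_n) w : H^t* = H ->
  hermmx (hermshift H w) = hermmx w + H.
Proof.
move=> /matrixP hH.
have {}hH i j : H i j = (H j i)^*%C by rewrite -[LHS]hH !mxE.
apply/matrixP => i j; rewrite !mxE !tnth_mktuple /shift /hermcoord.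
case: ltngtP => [_|_|/val_inj <-].
- by case: (H i j).
- by rewrite (hH i j); case: (H j i) => a b /=; apply/eqP; rewrite eq_complex /= opprD !eqxx.
- have := hH i i; case: (H i i) => u v [v0]; rewrite leqnn /=.
  by apply/eqP; rewrite eq_complex/= eqxx/=; apply/eqP; lra.
Qed.

Lemma preserves_hermshift n (H : 'M[C]_n) :
  preserves (@hermmx_lebesgue R n) (hermshift H).
Proof.
apply: preserves_power => i; apply: preserves_power => j; exact: preserves_shift.
Qed.

Lemma measurable_pack d (X : measurableType d) n (x : X -> T)
    (vr vi : X -> n.-tuple T) (w : X -> n.-tuple (n.-tuple T)) :
  measurable_fun setT x -> measurable_fun setT vr -> measurable_fun setT vi ->
  measurable_fun setT w ->
  measurable_fun setT (fun t => pack (x t) (vr t) (vi t) (w t)).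
Proof.
move=> mx mvr mvi mw; apply: measurable_tuple_cons_comp.
  exact: measurable_tuple_cons_comp.
exact: measurable_zipcons.
Qed.

Lemma mxmeasurable_cvec d (X : measurableType d) n (vr vi : X -> n.-tuple T) :
  measurable_fun setT vr -> measurable_fun setT vi ->
  mxmeasurable (fun t => cvec (vr t) (vi t)).
Proof.
move=> mvr mvi i j; under eq_fun do rewrite mxE.
by apply: cmeasurable_pair; exact: measurable_tnth_comp.
Qed.

Local Open Scope ereal_scope.

Local Notation L := (@lebesgue_measure R).

(** The outer power gives the first row; [ge0_integral_power_cons] on the remaining rows gives the
    first column. *)
Lemma ge0_integral_pack n (F : n.+1.-tuple (n.+1.-tuple T) -> \bar R) :
  measurable_fun setT F -> (forall w, 0 <= F w) ->
  \int[hermmx_lebesgue n.+1]_w F w =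
  \int[L]_x \int[power_measure L n]_vr \int[power_measure L n]_vi
    \int[hermmx_lebesgue n]_w F (pack x vr vi w).
Proof.
move=> mF F0.
rewrite [LHS]ge0_integral_powerS//.
under eq_integral => r _.
  rewrite ge0_integral_power_cons//; last by apply: measurableT_comp => //; meas.
  over.
rewrite ge0_integral_cons_measure//.
- apply: measurable_integral_snd; last by move=> *; apply: integral_ge0.
  apply: measurable_integral_snd => //.
  by apply: measurableT_comp => //; meas; apply: measurable_zipcons; meas.
- by move=> w; apply: integral_ge0 => a _; apply: integral_ge0.
Qed.

End pack.

(** * Measurability of the cone of positive definite matrices *)

Section schur.
Context {R : realType}.
Local Notation C := R[i].
Local Notation T := (measurableTypeR R).

(* [expR (- ln x)] is [x^-1] for [0 < x], and visibly measurable in [x]. *)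
Definition hermmx_schur n (w : n.+1.-tuple (n.+1.-tuple T)) : n.-tuple (n.-tuple T) :=
  let x := tnth (tnth w ord0) ord0 in
  let v := cvec [tuple tnth (tnth w ord0) (lift ord0 j) | j < n]
    [tuple tnth (tnth w (lift ord0 i)) ord0 | i < n] in
  [tuple [tuple tnth (tnth w (lift ord0 i)) (lift ord0 j) -
     hermcoord ((expR (- ln x))%:C *: (v^t* *m v)) i j | j < n] | i < n].

Lemma measurable_hermmx_schur n : measurable_fun setT (@hermmx_schur n).
Proof.
pose v (w : n.+1.-tuple (n.+1.-tuple T)) :=
  cvec [tuple tnth (tnth w ord0) (lift ord0 j) | j < n]
    [tuple tnth (tnth w (lift ord0 i)) ord0 | i < n].
have mv : mxmeasurable v by apply: mxmeasurable_cvec; meas.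
have mH : mxmeasurable (fun w : n.+1.-tuple (n.+1.-tuple T) =>
    ((expR (- ln (tnth (tnth w ord0) ord0 : R))%R)%:C *: ((v w)^t* *m v w))%R).
  apply: mxmeasurableZ; last by apply: mxmeasurable_mul => //; exact: mxmeasurable_ct.
  apply: cmeasurable_real; apply: (measurableT_comp (@measurable_expR R)).
  apply: measurable_funN; apply: (measurableT_comp (@measurable_ln R)).
  by meas.
have mc i j : measurable_fun setT (fun w : n.+1.-tuple (n.+1.-tuple T) => hermcoord
    ((expR (- ln (tnth (tnth w ord0) ord0 : R)))%:C *: ((v w)^t* *m v w)) i j).
  rewrite /hermcoord; case: (i <= j)%N; first exact: (proj1 (mH _ _)).
  exact: (proj2 (mH _ _)).
rewrite /hermmx_schur; meas.
by apply: measurable_funB; [meas|exact: mc].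
Qed.

Lemma packK n (w : n.+1.-tuple (n.+1.-tuple T)) :
  w = pack (tnth (tnth w ord0) ord0)
    [tuple tnth (tnth w ord0) (lift ord0 j) | j < n]
    [tuple tnth (tnth w (lift ord0 i)) ord0 | i < n]
    [tuple [tuple tnth (tnth w (lift ord0 i)) (lift ord0 j) | j < n] | i < n].
Proof.
apply: eq_from_tnth => i; apply: eq_from_tnth => j.
case: (unliftP ord0 i) => [i'|] ->; case: (unliftP ord0 j) => [j'|] ->;
  by rewrite /pack/= ?tnthS ?tnth_mktuple/= ?tnthS ?tnth_mktuple.
Qed.

Lemma hermcoordZN n (a : R) (M : 'M[C]_n) i j :
  hermcoord ((- a)%:C *: M) i j = - hermcoord (a%:C *: M) i j.
Proof.
rewrite /hermcoord; case: ifP => _; rewrite !mxE.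
  by case: (M i j) => b c /=; ring.
by case: (M j i) => b c /=; ring.
Qed.

Lemma hermmx_schurK n (w : n.+1.-tuple (n.+1.-tuple T)) :
  let x := tnth (tnth w ord0) ord0 in
  let vr := [tuple tnth (tnth w ord0) (lift ord0 j) | j < n] in
  let vi := [tuple tnth (tnth w (lift ord0 i)) ord0 | i < n] in
  (0 < x)%R ->
  hermmx w = block_mx (x%:C%:M : 'M[C]_1)%R (cvec vr vi) ((cvec vr vi)^t*)
    (hermmx (hermmx_schur w) + x^-1%:C *: ((cvec vr vi)^t* *m cvec vr vi))%R
    :> 'M[C]_(1 + n).
Proof.
move=> x vr vi x0.
have wE : w = pack x vr vi
    [tuple [tuple tnth (tnth w (lift ord0 i)) (lift ord0 j) | j < n] | i < n].
  exact: packK.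
set v := cvec vr vi.
have hv : ((- x^-1)%:C *: (v^t* *m v))^t* = ((- x^-1)%:C *: (v^t* *m v))%R.
  by rewrite ctZ ctM ctK.
have -> : hermmx_schur w = hermshift ((- x^-1)%:C *: (v^t* *m v))%R
    [tuple [tuple tnth (tnth w (lift ord0 i)) (lift ord0 j) | j < n] | i < n].
  apply: eq_from_tnth => i; apply: eq_from_tnth => j.
  rewrite !tnth_mktuple /shift; congr (_ + _)%R.
  rewrite -/x -/vr -/vi -/v expRN lnK//.
  by rewrite hermcoordZN.
rewrite hermmx_shift// -addrA -scalerDl.
have -> : ((- x^-1)%:C + x^-1%:C = 0 :> C)%R.
  by apply/eqP; rewrite eq_complex/= addNr addr0 !eqxx.
by rewrite scale0r addr0 {1}wE hermmx_pack.
Qed.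

(** By definition the cone is an uncountable intersection over vectors. The Schur complement
    replaces this by a recursion: the corner is positive and the complement, a measurable function
    of the coordinates, lies in the smaller cone. *)
Lemma measurable_posdefmx n :
  measurable [set w : n.-tuple (n.-tuple T) | posdefmx (hermmx w : 'M[C]_n)].
Proof.
elim: n => [|n IH].
  rewrite (_ : [set _ | _] = setT)//; apply/seteqP; split => // w _ /=.
  apply/posdefmxP; split; first exact/hermsymmxE/hermmx_hermsym.
  by move=> u; rewrite thinmx0 eqxx.
rewrite (_ : [set _ | _] =
  [set w : n.+1.-tuple (n.+1.-tuple T) | (0 < (tnth (tnth w ord0) ord0 : R))%R] `&`
  (@hermmx_schur n @^-1` [set w | posdefmx (hermmx w)])).
  apply: measurableI.
    rewrite -[X in measurable X]setTI.
    apply: (measurable_fun_ltr (f := fun=> 0%R)); [exact: measurable_cst|by meas|by []|].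
    by [].
  by rewrite -[X in measurable X]setTI; exact: measurable_hermmx_schur.
apply/seteqP; split => w /=.
- move=> pw; have x0 : (0 < (tnth (tnth w ord0) ord0 : R))%R.
    by move: pw; rewrite {1}[w]packK hermmx_pack => /posdefmx_block_gt0.
  by split => //; move: pw; rewrite hermmx_schurK// => /posdefmx_schur[]; rewrite ?gt_eqF.
- move=> [x0 ps]; rewrite hermmx_schurK//; apply/posdefmx_schur; rewrite ?gt_eqF//.
Qed.

End schur.

(** * The Gaussian integral of a quadratic form *)

Section gauss.
Context {R : realType}.
Local Notation C := R[i].
Local Notation T := (measurableTypeR R).
Local Notation L := (@lebesgue_measure R).
Local Notation P := (power_measure L).

Lemma cvec_cons n (a1 a2 : T) (vr vi : n.-tuple T) :
  cvec (tuple_cons (a1, vr)) (tuple_cons (a2, vi)) =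
  row_mx ((a1 +i* a2)%:M : 'M[C]_1) (cvec vr vi) :> 'rV[C]_(1 + n).
Proof.
have l0 : (ord0 : 'I_n.+1) = lshift n (ord0 : 'I_1) by exact: val_inj.
have lS i : lift (ord0 : 'I_n.+1) i = rshift 1 i by exact: val_inj.
have tS (a : T) (v : n.-tuple T) i : tnth (tuple_cons (a, v)) (lift ord0 i) = tnth v i.
  by rewrite /tuple_cons tnthS; congr tnth; exact: val_inj.
apply/matrixP => i j; rewrite ord1 mxE.
case: (unliftP (ord0 : 'I_n.+1) j) => [j'|] ->.
  by rewrite !tS [in RHS]lS row_mxEr mxE.
by rewrite [in RHS]l0 row_mxEl mxE eqxx.
Qed.

Definition tshift n (c : 'I_n -> R) : n.-tuple T -> n.-tuple T :=
  tuple_map_dep (fun i => shift (c i)).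

Lemma preserves_tshift n (c : 'I_n -> R) : preserves (P n) (tshift c).
Proof. by apply: preserves_power => i; exact: preserves_shift. Qed.

Lemma measurable_tshift d (X : measurableType d) n (c : 'I_n -> R)
    (f : X -> n.-tuple T) : measurable_fun setT f ->
  measurable_fun setT (fun x => tshift c (f x)).
Proof. exact: (measurableT_comp (proj1 (preserves_tshift c))). Qed.

Lemma cvec_shift n (vr vi : n.-tuple T) (c : 'rV[C]_n) :
  cvec (tshift (fun j => complex.Re (c 0 j)) vr)
       (tshift (fun j => complex.Im (c 0 j)) vi) = cvec vr vi + c.
Proof.
apply/rowP => j; rewrite !mxE !tnth_mktuple /shift.
by case: (c 0 j).
Qed.

Lemma integral_gauss_fun_scale (s : R) : 0 < s ->
  (\int[L]_x (expR (- (s * x ^+ 2)))%:E = (Num.sqrt pi / Num.sqrt s)%:E)%E.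
Proof.
move=> s0.
under eq_integral => x _.
  rewrite -[s in (s * _)%R]sqr_sqrtr ?ltW// -exprMn.
  over.
rewrite (@ge0_integral_scale _ (Num.sqrt s) (fun x => (gauss_fun x)%:E)) ?sqrtr_gt0//.
- by rewrite integralT_gauss -EFinM mulrC.
- by apply/measurable_EFinP; exact: measurable_gauss_fun.
- by move=> x; rewrite lee_fin gauss_fun_ge0.
Qed.

Local Open Scope ereal_scope.

Lemma measurable_app2 d d1 d2 d3 (X : measurableType d) (Y : measurableType d1)
    (Z : measurableType d2) (U : measurableType d3) (G : Y -> Z -> U)
    (f : X -> Y) (g : X -> Z) :
  measurable_fun setT (fun v : Y * Z => G v.1 v.2) ->
  measurable_fun setT f -> measurable_fun setT g ->
  measurable_fun setT (fun x => G (f x) (g x)).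
Proof.
by move=> mG mf mg; exact: (measurableT_comp mG (measurable_fun_pair mf mg)).
Qed.

Lemma ge0_integral_tshift2 n (c1 c2 : 'I_n -> R)
    (G : n.-tuple T -> n.-tuple T -> \bar R) :
  measurable_fun setT (fun v : n.-tuple T * n.-tuple T => G v.1 v.2) ->
  (forall vr vi, 0 <= G vr vi) ->
  \int[P n]_vr \int[P n]_vi G (tshift c1 vr) (tshift c2 vi) =
  \int[P n]_vr \int[P n]_vi G vr vi.
Proof.
move=> mG G0.
transitivity (\int[P n]_vr \int[P n]_vi G (tshift c1 vr) vi).
  apply: eq_integral => vr _.
  apply: (proj2 (preserves_tshift c2) (fun vi => G (tshift c1 vr) vi)) => //.
  by apply: (measurable_app2 mG); meas.
apply: (proj2 (preserves_tshift c1) (fun vr => \int[P n]_vi G vr vi)).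
- exact: measurable_integral_snd.
- by move=> vr; exact: integral_ge0.
Qed.

Lemma ge0_integralZl_setT d (X : measurableType d) (mu : {measure set X -> \bar R})
  (k : R) (f : X -> \bar R) : measurable_fun setT f ->
  (forall x, 0 <= f x) -> (0 <= k)%R ->
  \int[mu]_x (k%:E * f x) = k%:E * \int[mu]_x f x.
Proof. by move=> mf f0 k0; rewrite ge0_integralZl_EFin. Qed.

Lemma ge0_integral2Zl d1 d2 (X : measurableType d1) (Y : measurableType d2)
    (mu : {sigma_finite_measure set X -> \bar R})
    (nu : {sigma_finite_measure set Y -> \bar R}) (k : R) (G : X -> Y -> \bar R) :
  measurable_fun setT (fun v : X * Y => G v.1 v.2) ->
  (forall x y, 0 <= G x y) -> (0 <= k)%R ->
  \int[mu]_x \int[nu]_y (k%:E * G x y) = k%:E * \int[mu]_x \int[nu]_y G x y.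
Proof.
move=> mG G0 k0; rewrite -ge0_integralZl_setT//; first last.
- by move=> x; exact: integral_ge0.
- exact: measurable_integral_snd.
apply: eq_integral => x _; rewrite ge0_integralZl_setT//.
by apply: (measurable_app2 mG); meas.
Qed.

Lemma measurable_gauss_quad n d (X : measurableType d) (D : 'M[C]_n)
    (u : X -> 'rV[C]_n) : mxmeasurable u ->
  measurable_fun setT (fun x => (expR (- quad D (u x)))%:E).
Proof.
move=> mu; apply/measurable_EFinP; apply: (measurableT_comp (@measurable_expR R)).
by apply: measurable_funN; apply: measurable_quad => //; exact: mxmeasurable_cst.
Qed.

(** After the factorization of [D], the first complex coordinate translates the others by a multiple
    of [y], which their integral does not see. What remains of it is two real Gaussians of product
    pi / s, one for its real and one for its imaginary part. *)
Lemma integral_gauss_quad n (D : 'M[C]_n) : posdefmx D ->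
  \int[P n]_vr \int[P n]_vi (expR (- quad D (cvec vr vi)))%:E =
  (pi ^+ n / absdet D)%:E.
Proof.
elim: n D => [|n IH] D pD.
  rewrite /absdet det_mx00 normr1 expr0 divr1.
  have q0 vr vi : quad D (cvec vr vi) = 0%R.
    by rewrite /quad (_ : cvec vr vi = 0)%R ?mul0mx ?mxE//; apply/rowP => -[].
  under eq_integral do under eq_integral do rewrite q0 oppr0 expR0.
  by rewrite !integral_power0.
have [s [y [D' [s0 pD' dD DE]]]] := posdefmx_upper1P pD.
have mE d (X : measurableType d) (x1 : X -> T) (vr1 vi1 : X -> n.-tuple T) (x2 : X -> T) :
    measurable_fun setT x1 -> measurable_fun setT vr1 ->
    measurable_fun setT x2 -> measurable_fun setT vi1 ->
    measurable_fun setT (fun x => (expR (- quad D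
      (cvec (tuple_cons (x1 x, vr1 x)) (tuple_cons (x2 x, vi1 x)))))%:E).
  move=> m1 m2 m3 m4; apply: measurable_gauss_quad.
  by apply: mxmeasurable_cvec; apply: measurable_tuple_cons_comp.
rewrite ge0_integral_powerS; first last.
- by move=> w; apply: integral_ge0 => v _; rewrite lee_fin expR_ge0.
- apply: measurable_integral_snd; last by move=> *; rewrite lee_fin expR_ge0.
  by apply: measurable_gauss_quad; apply: mxmeasurable_cvec; meas.
pose k := (pi ^+ n / absdet D')%R.
have k0 : (0 <= k)%R.
  by rewrite divr_ge0// ?exprn_ge0 ?pi_ge0// ltW// absdet_gt0.
pose e (a : R) := (expR (- (s * a ^+ 2)))%:E.
have e0 a : 0 <= e a by rewrite lee_fin expR_ge0.
have me : measurable_fun setT (e : T -> _).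
  apply/measurable_EFinP; apply: (measurableT_comp (@measurable_expR R)).
  apply: measurable_funN; apply: measurable_funM; first exact: measurable_cst.
  exact: measurable_funX.
have mG : measurable_fun setT (fun v : n.-tuple T * n.-tuple T =>
    (expR (- quad D' (cvec v.1 v.2)))%:E).
  by apply: measurable_gauss_quad; apply: mxmeasurable_cvec; meas.
transitivity (\int[L]_a1 \int[L]_a2 (e a1 * e a2 * k%:E)).
  apply: eq_integral => a1 _.
  under eq_integral => vr _.
    rewrite ge0_integral_powerS; first last.
    - by move=> w; rewrite lee_fin expR_ge0.
    - by apply: measurable_gauss_quad; apply: mxmeasurable_cvec; meas.
    over.
  (* The imaginary part [a2] of the first coordinate is moved out of the integral over the real
     parts of the others, so that [a1] and [a2] are both fixed when those are translated. *)
  rewrite ge0_integral_swap; first last.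
  - by move=> *; apply: integral_ge0 => v _; rewrite lee_fin expR_ge0.
  - apply: measurable_integral_snd; last by move=> *; rewrite lee_fin expR_ge0.
    by apply: mE; meas.
  apply: eq_integral => a2 _.
  transitivity (\int[P n]_vr \int[P n]_vi
      ((expR (- (s * a1 ^+ 2)) * expR (- (s * a2 ^+ 2)))%:E *
       (expR (- quad D' (cvec vr vi + (a1 +i* a2) *: y)))%:E)).
    apply: eq_integral => vr _; apply: eq_integral => vi _.
    by rewrite cvec_cons DE quad_upper1 -EFinM -!expRD; congr (expR _)%:E; ring.
  under eq_integral do under eq_integral do rewrite -cvec_shift.
  rewrite ge0_integral2Zl.
  - by rewrite (@ge0_integral_tshift2 _ _ _
      (fun vr vi => (expR (- quad D' (cvec vr vi)))%:E))// IH.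
  - apply: (@measurable_app2 _ _ _ _ _ _ _ _
      (fun vr vi => (expR (- quad D' (cvec vr vi)))%:E) _ _ mG);
    by apply: measurable_tshift; meas.
  - by move=> *; rewrite lee_fin expR_ge0.
  - by rewrite mulr_ge0 ?expR_ge0.
under eq_integral do under eq_integral do rewrite -muleA (muleC (e _) k%:E).
under eq_integral => a1 _.
  rewrite ge0_integralZl//; last first.
  + by move=> a2 _; rewrite mule_ge0.
  + by apply: emeasurable_funM => //; exact: measurable_cst.
  rewrite ge0_integralZl_setT// integral_gauss_fun_scale//.
  over.
have ge : \int[L]_x e x = (Num.sqrt pi / Num.sqrt s)%:E by exact: integral_gauss_fun_scale.
rewrite ge0_integralZr// ?ge -?EFinM; last first.
  by rewrite lee_fin mulr_ge0// divr_ge0// sqrtr_ge0.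
congr (_%:E).
have ss : (Num.sqrt s * Num.sqrt s = s)%R by rewrite -expr2 sqr_sqrtr// ltW.
have pp : (Num.sqrt pi * Num.sqrt pi = pi :> R)%R by rewrite -expr2 sqr_sqrtr// pi_ge0.
have ss0 : Num.sqrt s != 0%R by rewrite sqrtr_eq0 -ltNge.
have dd0 : absdet D' != 0%R by rewrite gt_eqF ?absdet_gt0.
rewrite dD /k exprS.
transitivity ((Num.sqrt pi * Num.sqrt pi) * pi ^+ n /
  ((Num.sqrt s * Num.sqrt s) * absdet D'))%R; last by rewrite pp ss.
by field; rewrite ss0 dd0.
Qed.

End gauss.

(** * The law of the determinant *)

Section wishart.
Context {R : realType}.
Local Notation C := R[i].
Local Notation T := (measurableTypeR R).
Local Notation L := (@lebesgue_measure R).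
Local Notation P := (power_measure L).

(* Under the weight exp(- tr (A X)), |det X| |det A| is distributed as a product of
   independent gamma variables (Bartlett decomposition), up to the powers of [pi]
   that come from the Gaussian integrals. *)
Definition gamma_density (m : nat) (x : R) : R :=
  if 0 < x then pi ^+ m * x ^+ m * expR (- x) else 0.

Lemma gamma_density_ge0 m x : 0 <= gamma_density m x.
Proof.
rewrite /gamma_density; case: ifP => // x0.
by rewrite !mulr_ge0 ?exprn_ge0 ?pi_ge0 ?expR_ge0// ltW.
Qed.

Lemma measurable_gamma_density m : measurable_fun setT (gamma_density m : T -> R).
Proof.
apply: measurable_fun_ifT.
- by apply: measurable_fun_ltr; [exact: measurable_cst|exact: measurable_id].
- apply: measurable_funM; last first.
    apply: (measurableT_comp (@measurable_expR R)).
    by apply: measurable_funN; exact: measurable_id.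
  apply: measurable_funM; first exact: measurable_cst.
  by apply: measurable_funX; exact: measurable_id.
- exact: measurable_cst.
Qed.

(** The index [n - i.+1] is the length of the vector v at the i-th splitting: its Gaussian integral
    contributes that power of pi and of x. *)
Definition bartlett_density n (t : n.-tuple T) : R :=
  \prod_(i < n) gamma_density (n - i.+1) (tnth t i).

Definition tuple_prod n (t : n.-tuple T) : R := \prod_(i < n) tnth t i.

Lemma bartlett_density_cons n x (t : n.-tuple T) :
  bartlett_density (tuple_cons (x, t)) = gamma_density n x * bartlett_density t.
Proof.
rewrite /bartlett_density big_ord_recl subn1; congr (_ * _).
by apply: eq_bigr => i _; rewrite lift0 subSS /tuple_cons tnthS.
Qed.

Lemma tuple_prod_cons n x (t : n.-tuple T) :
  tuple_prod (tuple_cons (x, t)) = x * tuple_prod t.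
Proof.
rewrite /tuple_prod big_ord_recl; congr (_ * _).
by apply: eq_bigr => i _; rewrite /tuple_cons tnthS.
Qed.

Lemma bartlett_density_ge0 n (t : n.-tuple T) : 0 <= bartlett_density t.
Proof. by apply: prodr_ge0 => i _; exact: gamma_density_ge0. Qed.

Lemma measurable_prod_ord d (X : measurableType d) n (F : 'I_n -> X -> R) :
  (forall i, measurable_fun setT (F i)) ->
  measurable_fun setT (fun x => \prod_(i < n) F i x).
Proof.
elim: n F => [|n IH] F mF.
  by under eq_fun do rewrite big_ord0; exact: measurable_cst.
under eq_fun do rewrite big_ord_recl.
by apply: measurable_funM => //; exact: IH.
Qed.

Lemma measurable_bartlett_density n : measurable_fun setT (@bartlett_density n).
Proof.
apply: measurable_prod_ord => i.
apply: (measurableT_comp (measurable_gamma_density _)).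
exact: measurable_tnth.
Qed.

Lemma measurable_tuple_prod n : measurable_fun setT (@tuple_prod n).
Proof. by apply: measurable_prod_ord => i; exact: measurable_tnth. Qed.

Definition posdef_set n : set (n.-tuple (n.-tuple T)) :=
  [set w | posdefmx (hermmx w : 'M[C]_n)].

(** The unnormalized complex Wishart density, with [h] in place of the power of the determinant. The
    cone enters as an indicator factor, so that integrals run over the whole coordinate space and
    can be translated. *)
Definition wishart n (A : 'M[C]_n) (h : R -> R) (w : n.-tuple (n.-tuple T)) : R :=
  \1_(@posdef_set n) w *
  (h (absdet (hermmx w)) * expR (- rtrace A (hermmx w))).

Lemma measurable_wishart n d (X : measurableType d) (A : X -> 'M[C]_n) (h : R -> R)
    (w : X -> n.-tuple (n.-tuple T)) :
  mxmeasurable A -> measurable_fun setT h -> measurable_fun setT w ->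
  measurable_fun setT (fun x => wishart (A x) h (w x)).
Proof.
move=> mA mh mw; apply: measurable_funM.
  apply: (measurableT_comp _ mw); apply: measurable_indic.
  exact: measurable_posdefmx.
apply: measurable_funM.
  apply: (measurableT_comp mh); apply: measurable_absdet.
  exact: mxmeasurable_hermmx.
apply: (measurableT_comp (@measurable_expR R)); apply: measurable_funN.
by apply: measurable_rtrace => //; exact: mxmeasurable_hermmx.
Qed.

Lemma wishart_ge0 n (A : 'M[C]_n) h w : (forall r, 0 <= h r) -> 0 <= wishart A h w.
Proof. by move=> h0; rewrite /wishart !mulr_ge0// ?indicE// expR_ge0. Qed.

Lemma wishart_pack_le0 n (A : 'M[C]_n.+1) h x (vr vi : n.-tuple T) w : x <= 0 ->
  wishart A h (pack x vr vi w) = 0.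
Proof.
move=> x0; rewrite /wishart indicE memNset ?mul0r//.
by rewrite /posdef_set/= hermmx_pack => /posdefmx_block_gt0; rewrite ltNge x0.
Qed.

Lemma wishart_pack n (s : R) y D h (x : R) (vr vi : n.-tuple T) w : 0 < x ->
  let v := cvec vr vi in
  wishart (upper1 y *m block_mx (s%:C%:M : 'M[C]_1) 0 0 D *m (upper1 y)^t*)
    h (pack x vr vi (hermshift (x^-1%:C *: (v^t* *m v)) w)) =
  expR (- (s * x)) * expR (- quad (x^-1%:C *: D) (v + x%:C *: y)) *
  wishart D (fun r => h (x * r)) w.
Proof.
move=> x0 v; have xn0 : x != 0 by rewrite gt_eqF.
have hv : (x^-1%:C *: (v^t* *m v))^t* = x^-1%:C *: (v^t* *m v).
  by rewrite ctZ ctM ctK.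
rewrite /wishart hermmx_pack hermmx_shift// -/v absdet_schur// rtrace_schur//.
have -> : (\1_(@posdef_set n.+1) (pack x vr vi (hermshift (x^-1%:C *: (v^t* *m v)) w)) : R) =
    \1_(@posdef_set n) w.
  rewrite !indicE; congr (_%:R); congr nat_of_bool.
  apply/idP/idP; rewrite !inE /posdef_set/= hermmx_pack hermmx_shift// -/v.
    by move=> /(posdefmx_schur _ _ xn0)[].
  by move=> pw; exact/(posdefmx_schur _ _ xn0).
by rewrite quadZ !opprD !expRD; ring.
Qed.

Local Open Scope ereal_scope.

(** By induction on the size for all [h] at once, since the induction hypothesis is applied to r |->
    h (x r), where x is the corner split off. The right side depends on [A] only through |det A|. *)
Lemma wishart_law n (A : 'M[C]_n) (h : R -> R) : posdefmx A ->
  measurable_fun setT h -> (forall r, 0 <= h r)%R ->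
  \int[@hermmx_lebesgue R n]_w (wishart A h w)%:E =
  ((absdet A) ^- n)%:E *
    \int[P n]_t (bartlett_density t * h (tuple_prod t / absdet A))%:E.
Proof.
elim: n A h => [|n IH] A h pA mh h0.
  rewrite /absdet det_mx00 normr1 expr0 invr1 mul1e.
  rewrite !integral_power0.
  congr EFin; rewrite /wishart indicE mem_set; last first.
    apply/posdefmxP; split; first exact/hermsymmxE/hermmx_hermsym.
    by move=> u; rewrite thinmx0 eqxx.
  rewrite /bartlett_density /tuple_prod !big_ord0 /absdet det_mx00 normr1.
  by rewrite /rtrace /mxtrace big_ord0 oppr0 expR0 !mul1r mulr1.
have [s [y [D [s0 pD dA AE]]]] := posdefmx_upper1P pA.
set d := absdet D in dA.
have d0 : (0 < d)%R by exact: absdet_gt0.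
(* The inner integral once the first gamma variable has the value [t0], which will be s x; the
   argument of [h] is divided by s d = |det A|. *)
pose M (t0 : T) := \int[P n]_t (bartlett_density t * h (t0 * (tuple_prod t / (s * d))))%:E.
have mM2 : measurable_fun setT (fun v : T * n.-tuple T =>
    (bartlett_density v.2 * h (v.1 * (tuple_prod v.2 / (s * d))))%:E).
  apply/measurable_EFinP; apply: measurable_funM.
    by apply: (measurableT_comp (@measurable_bartlett_density n)); meas.
  apply: (measurableT_comp mh); apply: measurable_funM; first by meas.
  apply: measurable_funM; last exact: measurable_cst.
  by apply: (measurableT_comp (@measurable_tuple_prod n)); meas.
have M20 (t0 : T) (t : n.-tuple T) :
    0 <= (bartlett_density t * h (t0 * (tuple_prod t / (s * d))))%:E.
  by rewrite lee_fin mulr_ge0// bartlett_density_ge0.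
have M0 t0 : 0 <= M t0 by apply: integral_ge0.
have mM : measurable_fun setT M by exact: measurable_integral_snd.
have mF : measurable_fun setT (fun w => (wishart A h w)%:E).
  apply/measurable_EFinP; apply: measurable_wishart => //; exact: mxmeasurable_cst.
have F0 w : 0 <= (wishart A h w)%:E by rewrite lee_fin wishart_ge0.
rewrite ge0_integral_pack//.
(* The induction hypothesis gives d^-n and the Gaussian integral over v one more d^-1; s^-n
   compensates the power (s x)^n in the gamma weight. The last s^-1 will come from the dilation t =
   s x. *)
pose c := (s ^- n * d ^- n.+1)%R.
have c0 : (0 <= c)%R by rewrite mulr_ge0// invr_ge0 exprn_ge0// ltW.
transitivity (\int[L]_x (c%:E * ((gamma_density n (s * x))%:E * M (s * x)%R))).
  apply: eq_integral => x _.
  have [x0|x0] := leP x 0%R.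
    rewrite /gamma_density ltNge pmulr_rle0// x0/= mul0e mule0.
    under eq_integral do under eq_integral do under eq_integral do
      rewrite wishart_pack_le0//.
    under eq_integral do under eq_integral do rewrite integral0.
    by under eq_integral do rewrite integral0; rewrite integral0.
  have xn0 : x != 0%R by rewrite gt_eqF.
  pose g (vr vi : n.-tuple T) := (expR (- quad (x^-1%:C *: D) (cvec vr vi + x%:C *: y)))%:E.
  have mg : measurable_fun setT (fun v : n.-tuple T * n.-tuple T => g v.1 v.2).
    apply: measurable_gauss_quad; apply: mxmeasurableD; last exact: mxmeasurable_cst.
    by apply: mxmeasurable_cvec; meas.
  have g0 vr vi : 0 <= g vr vi by rewrite lee_fin expR_ge0.
  pose k := (expR (- (s * x)) * d ^- n)%R.
  have k0 : (0 <= k)%R by rewrite mulr_ge0 ?expR_ge0// invr_ge0 exprn_ge0// ltW.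
  transitivity (\int[P n]_vr \int[P n]_vi (g vr vi * (k%:E * M (s * x)%R))).
    apply: eq_integral => vr _; apply: eq_integral => vi _.
    set v := cvec vr vi.
    (* For fixed x and v, the lower right block is translated by x^-1 v^* v, so that [w] becomes its
       Schur complement. *)
    rewrite -(proj2 (preserves_hermshift (x^-1%:C *: (v^t* *m v))%R)
      (fun w => (wishart A h (pack x vr vi w))%:E)); last 2 first.
    - by apply: (measurableT_comp mF); apply: measurable_pack; meas.
    - by [].
    transitivity (\int[hermmx_lebesgue n]_w
        ((expR (- (s * x)) * expR (- quad (x^-1%:C *: D) (v + x%:C *: y)))%:E *
         (wishart D (fun r => h (x * r)) w)%:E)).
      by apply: eq_integral => w _; rewrite AE wishart_pack.
    rewrite ge0_integralZl_setT; first last.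
    - by rewrite mulr_ge0 ?expR_ge0.
    - by move=> w; rewrite lee_fin wishart_ge0.
    - apply/measurable_EFinP; apply: measurable_wishart => //.
      by apply: (measurableT_comp mh); apply: measurable_funM => //; exact: measurable_cst.
    rewrite IH//; last first.
      by apply: (measurableT_comp mh); apply: measurable_funM => //; exact: measurable_cst.
    rewrite -/d muleA -EFinM [X in _ = _ * (_ * X)](_ : _ =
       \int[P n]_t (bartlett_density t * h (x * (tuple_prod t / d)))%:E); last first.
      apply: eq_integral => t _; congr ((_ * h _)%:E).
      by field; rewrite !gt_eqF.
    rewrite muleA; congr (_ * _); rewrite /g /k -EFinM; congr (_%:E).
    by rewrite -/v; ring.
  have kM0 : 0 <= k%:E * M (s * x)%R by rewrite mule_ge0.
  under eq_integral => vr _.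
    rewrite ge0_integralZr//; last by apply: (measurable_app2 (G := g) mg); meas.
    over.
  rewrite ge0_integralZr//; first last.
  - by move=> *; exact: integral_ge0.
  - exact: measurable_integral_snd.
  have -> : \int[P n]_vr \int[P n]_vi g vr vi = (pi ^+ n / (x ^- n * d))%:E.
    under eq_integral do under eq_integral do rewrite /g -cvec_shift.
    rewrite (@ge0_integral_tshift2 _ _ _ _
      (fun vr vi => (expR (- quad (x^-1%:C *: D) (cvec vr vi)))%:E)).
    - rewrite integral_gauss_quad; last by apply: posdefmxZ; rewrite ?invr_gt0.
      by rewrite absdetZ ?invr_ge0 ?ltW// exprVn.
    - by apply: measurable_gauss_quad; apply: mxmeasurable_cvec; meas.
    - by move=> *; rewrite lee_fin expR_ge0.
  rewrite !muleA -!EFinM; congr (_%:E * _).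
  rewrite /gamma_density mulr_gt0// /k /c exprMn exprS.
  by field; rewrite !expf_neq0 ?gt_eqF.
rewrite ge0_integralZl_setT//; first last.
- by move=> x; rewrite mule_ge0// lee_fin gamma_density_ge0.
- have ms : measurable_fun setT (fun x : T => (s * x)%R : T).
    by apply: measurable_funM => //; exact: measurable_cst.
  apply: emeasurable_funM.
    by apply/measurable_EFinP; exact: (measurableT_comp (measurable_gamma_density n) ms).
  exact: (measurableT_comp mM ms).
rewrite (@ge0_integral_scale _ s (fun t0 => (gamma_density n t0)%:E * M t0))//; last 2 first.
- apply: emeasurable_funM => //.
  by apply/measurable_EFinP; exact: measurable_gamma_density.
- by move=> x; rewrite mule_ge0// lee_fin gamma_density_ge0.
rewrite muleA -EFinM; congr (_%:E * _).
  rewrite /c dA exprMn !exprS; by field; rewrite !expf_neq0 ?gt_eqF.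
rewrite ge0_integral_powerS; last 2 first.
- apply/measurable_EFinP; apply: measurable_funM.
    exact: measurable_bartlett_density.
  apply: (measurableT_comp mh); apply: measurable_funM; last exact: measurable_cst.
  exact: measurable_tuple_prod.
- by move=> w; rewrite lee_fin mulr_ge0// bartlett_density_ge0.
apply: eq_integral => t0 _.
rewrite -ge0_integralZl_EFin//; last 2 first.
- by apply: (measurable_app2 (G := fun (t0 : T) (t : n.-tuple T) =>
    (bartlett_density t * h (t0 * (tuple_prod t / (s * d))))%:E) mM2); meas.
- exact: gamma_density_ge0.
apply: eq_integral => t _; rewrite -EFinM bartlett_density_cons tuple_prod_cons dA.
by rewrite !mulrA.
Qed.

End wishart.

(** * Convergence of the gamma integral *)

Section gamma_finite.
Context {R : realType}.
Local Notation L := (@lebesgue_measure R).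
Implicit Types (x t : R).

(** The primitive t^x is evaluated at both ends. The lower end [k.+2%:R^-1] stays positive, where
    t^x is differentiable, and strictly below 1 even for k = 0, as the fundamental theorem of
    calculus asks. *)
Lemma integral_powR_itv x (k : nat) : 0 < x ->
  (\int[L]_(t in `[(k.+2%:R^-1)%R, 1%R]) (x * t `^ (x - 1))%:E <= 1%:E)%E.
Proof.
move=> x0.
have k1 : (k.+2%:R^-1 < 1 :> R) by rewrite invf_lt1// ltr1n.
have k0 : (0 < k.+2%:R^-1 :> R) by rewrite invr_gt0.
have dF t : 0 < t -> derivable (fun t : R => t `^ x) t 1.
  by move=> t0; apply: derivable_powR; rewrite in_itv/= t0.
have cF t : 0 < t -> (fun t : R => t `^ x) @ t --> t `^ x.
  by move=> t0; have /derivable1_diffP/differentiable_continuous := dF t t0.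
rewrite (@continuous_FTC2 _ _ (fun t => t `^ x))//.
- by rewrite powR1 -EFinB lee_fin lerBlDr lerDl powR_ge0.
- apply: derivable_within_continuous => t; rewrite in_itv/= => /andP[kt _].
  have t0 : 0 < t by exact: lt_le_trans kt.
  apply: derivableM => //; apply: derivable_powR.
  by rewrite in_itv/= t0.
- split.
  + by move=> t; rewrite in_itv/= => /andP[kt _]; apply: dF; exact: lt_trans kt.
  + by apply: cvg_at_right_filter; exact: cF.
  + by apply: cvg_at_left_filter; exact: cF.
- move=> t; rewrite in_itv/= => /andP[kt _]; rewrite powR_derive1//.
  by rewrite in_itv/= andbT; exact: lt_trans kt.
Qed.

Lemma measurable_powR_fun (x : R) : measurable_fun setT (fun t : R => (x * t `^ (x - 1))).
Proof. by apply: measurable_funM => //; exact: measurable_powR. Qed.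

(** Monotone limit of the integrals over intervals away from 0. *)
Lemma integral_powR01 x : 0 < x ->
  (\int[L]_(t in `]0%R, 1%R]) (x * t `^ (x - 1))%:E <= 1%:E)%E.
Proof.
move=> x0.
have bE : `]0%R, 1%R]%classic = \bigcup_k `[k.+2%:R^-1, 1%R]%classic :> set R.
  apply/seteqP; split => t /=; rewrite ?in_itv/=.
    move=> /andP[t0 t1]; have [n _ nt] := near_infty_natSinv_lt (PosNum t0).
    exists n => //=; rewrite in_itv/= t1 andbT ltW//.
    by apply: le_lt_trans (nt n (leqnn _)); rewrite lef_pV2 ?posrE// ler_nat.
  move=> [k _] /=; rewrite in_itv/= => /andP[kt ->]; rewrite andbT.
  by apply: lt_le_trans kt; rewrite invr_gt0.
rewrite bE.
have nd : nondecreasing_seq (fun k => `[k.+2%:R^-1, 1%R]%classic : set R).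
  move=> m n mn; apply/subsetPset => t /=; rewrite !in_itv/= => /andP[mt ->].
  by rewrite andbT; apply: le_trans mt; rewrite lef_pV2 ?posrE// ler_nat.
have h : ((\int[L]_(t in `[(k.+2%:R^-1)%R, 1%R]) (x * t `^ (x - 1))%:E)%E @[k --> \oo] -->
   (\int[L]_(t in \bigcup_k `[(k.+2%:R^-1)%R, 1%R]%classic) (x * t `^ (x - 1))%:E)%E).
  apply: ge0_nondecreasing_set_cvg_integral => //.
  - by move=> k; apply/measurable_funTS/measurable_EFinP; exact: measurable_powR_fun.
  - by move=> k t _; rewrite lee_fin mulr_ge0 ?powR_ge0// ltW.
rewrite -(cvg_lim _ h)//; apply: lime_le; first by apply/cvg_ex; eexists; exact: h.
by apply: nearW => k; exact: integral_powR_itv.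
Qed.

Lemma powR_le_expR x : exists2 K : R, 0 < K & forall t, 1 <= t ->
  t `^ x <= K * expR (t / 2).
Proof.
(* Multiplying ln u < u by [c] at u = t / (2 c) gives c ln t < t / 2 + c ln (2 c), hence the
   constant (2 c)^c; [c] is a positive bound of [x]. *)
pose c := `|x| + 1.
have c0 : 0 < c by rewrite ltr_wpDl.
exists (expR (c * ln (2 * c))); first exact: expR_gt0.
move=> t t1; have t0 : 0 < t by exact: lt_le_trans t1.
rewrite /powR gt_eqF// -expRD ler_expR.
have lt0 : 0 <= ln t by exact: ln_ge0.
apply: (@le_trans _ _ (c * ln t)).
  by rewrite ler_wpM2r// (le_trans (ler_norm _))// lerDl.
have c20 : 0 < 2 * c by rewrite mulr_gt0.
have : ln (t / (2 * c)) < t / (2 * c) by apply: ln_sublinear; rewrite divr_gt0.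
rewrite ln_div ?posrE// ltrBlDr => h.
have -> : c * ln (2 * c) + t / 2 = c * (t / (2 * c) + ln (2 * c)).
  by field; rewrite gt_eqF.
by rewrite ler_wpM2l// ltW.
Qed.

Definition gamma_fun x t : R := t `^ (x - 1) * expR (- t).

Lemma measurable_gamma_fun x : measurable_fun setT (gamma_fun x).
Proof.
apply: measurable_funM; first exact: measurable_powR.
by apply: (measurableT_comp (@measurable_expR R)); exact: measurable_funN.
Qed.

Lemma gamma_fun_ge0 x t : 0 <= gamma_fun x t.
Proof. by rewrite mulr_ge0 ?powR_ge0 ?expR_ge0. Qed.

Lemma integral_gamma_fun_lty x : 0 < x ->
  (\int[L]_(t in `]0%R, +oo[) (gamma_fun x t)%:E < +oo)%E.
Proof.
move=> x0.
have -> : `]0%R, +oo[%classic = `]0%R, 1%R] `|` `]1%R, +oo[ :> set R.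
  by rewrite -itv_bndbnd_setU// bnd_simp.
rewrite ge0_integral_setU//=; last 3 first.
- by apply/measurable_funTS/measurable_EFinP; exact: measurable_gamma_fun.
- by move=> t _; rewrite lee_fin gamma_fun_ge0.
- rewrite disj_set2E; apply/eqP/seteqP; split => t //=.
  by rewrite !in_itv/= andbT => -[/andP[_ t1]]; rewrite ltNge t1.
apply: lte_add_pinfty.
  apply: (@le_lt_trans _ _ (\int[L]_(t in `]0%R, 1%R]) (x^-1%:E * (x * t `^ (x - 1))%:E))%E).
    apply: ge0_le_integral => //.
    - by move=> t _; rewrite lee_fin gamma_fun_ge0.
    - by apply/measurable_funTS/measurable_EFinP; exact: measurable_gamma_fun.
    - apply/measurable_funTS/measurable_EFinP/measurable_funM => //.
      exact: measurable_powR_fun.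
    - move=> t; rewrite /= in_itv/= => /andP[t0 t1].
      rewrite -EFinM lee_fin mulrA mulVf ?gt_eqF// mul1r.
      by rewrite /gamma_fun ler_piMr ?powR_ge0// -expR0 ler_expR oppr_le0 ltW.
  rewrite ge0_integralZl_EFin//; last 3 first.
  - by move=> t _; rewrite lee_fin mulr_ge0 ?powR_ge0// ltW.
  - by apply/measurable_funTS/measurable_EFinP; exact: measurable_powR_fun.
  - by rewrite invr_ge0 ltW.
  by rewrite lte_mul_pinfty// ?lee_fin ?invr_ge0 ?ltW//
    (le_lt_trans (integral_powR01 x0))// ltry.
have [K K0 hK] := powR_le_expR (x - 1).
(* Beyond 1 the integrand is at most K exp(- t / 2), that is, 2 K times the exponential density of
   rate 1/2, whose mass is 1. *)
apply: (@le_lt_trans _ _ (\int[L]_(t in `]1%R, +oo[)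
    ((K * 2)%:E * (exponential_pdf 2^-1 t)%:E))%E).
  apply: ge0_le_integral => //.
  - by move=> t _; rewrite lee_fin gamma_fun_ge0.
  - by apply/measurable_funTS/measurable_EFinP; exact: measurable_gamma_fun.
  - by apply/measurable_funTS/measurable_EFinP/measurable_funM => //;
      exact: measurable_exponential_pdf.
  - move=> t; rewrite /= in_itv/= andbT => t1.
    have t0 : 0 <= t by rewrite (le_trans ler01)// ltW.
    rewrite -EFinM lee_fin exponential_pdfE// /gamma_fun.
    apply: (@le_trans _ _ (K * expR (t / 2) * expR (- t))).
      by rewrite ler_wpM2r ?expR_ge0// hK// ltW.
    rewrite -mulrA -expRD mulrA -[K * 2 * 2^-1]mulrA divff// mulr1.
    by rewrite ler_pM2l// ler_expR; lra.
rewrite ge0_integralZl_EFin//; last 3 first.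
- by move=> t _; rewrite lee_fin exponential_pdf_ge0.
- by apply/measurable_funTS/measurable_EFinP; exact: measurable_exponential_pdf.
- by rewrite mulr_ge0// ltW.
rewrite lte_mul_pinfty// ?lee_fin ?mulr_ge0 ?ltW//.
apply: (@le_lt_trans _ _ (\int[L]_t (exponential_pdf 2^-1 t)%:E)%E).
  apply: ge0_subset_integral => //.
  - by apply/measurable_EFinP; exact: measurable_exponential_pdf.
  - by move=> t _; rewrite lee_fin exponential_pdf_ge0.
by rewrite integral_exponential_pdf ?ltry.
Qed.

End gamma_finite.

(** * Integrals of complex functions *)

Section cabs.
Context {R : realType}.
Local Notation C := R[i].
Implicit Types z w : C.

Definition cabs z : R := complex.Re `|z|.

Lemma cabsE z : cabs z = Num.sqrt (complex.Re z ^+ 2 + complex.Im z ^+ 2).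
Proof. by rewrite /cabs normc_def. Qed.

Lemma cabs_ge0 z : 0 <= cabs z.
Proof. by rewrite cabsE sqrtr_ge0. Qed.

Lemma cabsM z w : cabs (z * w) = cabs z * cabs w.
Proof. by rewrite /cabs normrM !normc_def/=; ring. Qed.

Lemma cabs1 : cabs 1 = 1.
Proof. by rewrite /cabs normr1. Qed.

Lemma cabs_real (r : R) : cabs r%:C = `|r|.
Proof. by rewrite cabsE/= expr0n/= addr0 sqrtr_sqr. Qed.

Lemma cabs_prod n (F : 'I_n -> C) :
  cabs (\prod_i F i) = \prod_i cabs (F i).
Proof. exact: (big_morph _ cabsM cabs1). Qed.

Lemma Re_le_cabs z : `|complex.Re z| <= cabs z.
Proof. by rewrite cabsE -sqrtr_sqr ler_wsqrtr// lerDl sqr_ge0. Qed.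

Lemma Im_le_cabs z : `|complex.Im z| <= cabs z.
Proof. by rewrite cabsE -sqrtr_sqr ler_wsqrtr// lerDr sqr_ge0. Qed.

Lemma cabs_le_ReIm z : cabs z <= `|complex.Re z| + `|complex.Im z|.
Proof.
rewrite cabsE -[leRHS]ger0_norm ?addr_ge0// -sqrtr_sqr ler_wsqrtr//.
by rewrite sqrrD !real_normK ?num_real// lerD2r lerDl mulrn_wge0//.
Qed.

Lemma cabs_cexp z : cabs (cexp z) = expR (complex.Re z).
Proof.
rewrite cabsE /= !exprMn -mulrDr cos2Dsin2 mulr1 sqrtr_sqr ger0_norm//.
Qed.

Lemma cexpD z w : cexp (z + w) = cexp z * cexp w.
Proof.
case: z w => [a b] [a' b']; rewrite /cexp/= expRD cosD sinD.
by apply/eqP; rewrite eq_complex/=; apply/andP; split; apply/eqP; ring.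
Qed.

Lemma cexp_real (r : R) : cexp r%:C = (expR r)%:C.
Proof. by rewrite /cexp/= cos0 sin0 mulr1 mulr0. Qed.

Lemma cabs_cpow (t : R) z : cabs (cpow t z) = expR (complex.Re z * ln t).
Proof. by rewrite /cpow cabs_cexp; case: z => a b /=; rewrite mulr0 subr0. Qed.

Lemma cpowD (t : R) z w : cpow t (z + w) = cpow t z * cpow t w.
Proof. by rewrite /cpow mulrDl cexpD. Qed.

Lemma cpow0 (t : R) : cpow t 0 = 1.
Proof. by rewrite /cpow mul0r (cexp_real 0) expR0. Qed.

Lemma cpow_sum (t : R) n (z : 'I_n -> C) :
  cpow t (\sum_i z i) = \prod_i cpow t (z i).
Proof. exact: (big_morph _ (cpowD t) (cpow0 t)). Qed.

Lemma cpowM (t u : R) z : 0 < t -> 0 < u -> cpow (t * u) z = cpow t z * cpow u z.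
Proof.
move=> t0 u0; rewrite /cpow lnM ?posrE// -cexpD -mulrDr; congr (cexp (_ * _)).
by apply/eqP; rewrite eq_complex/= addr0 !eqxx.
Qed.

Lemma cpow1 z : cpow 1 z = 1.
Proof. by rewrite /cpow ln1 mulr0 (cexp_real 0) expR0. Qed.

Lemma cpowV (t : R) z : 0 < t -> cpow t^-1 z = cpow t (- z).
Proof.
move=> t0; rewrite /cpow lnV ?posrE//; congr cexp.
by case: z => a b; apply/eqP; rewrite eq_complex/=; apply/andP; split; apply/eqP; ring.
Qed.

Lemma cpow_realE (t x : R) : cpow t x%:C = (expR (x * ln t))%:C.
Proof.
rewrite /cpow -cexp_real; congr cexp.
by apply/eqP; rewrite eq_complex/=; apply/andP; split; apply/eqP; ring.
Qed.

Lemma natr_real_complex (m : nat) : m%:R = (m%:R : R)%:C.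
Proof.
elim: m => [//|m IH]; rewrite !mulrS IH.
by apply/eqP; rewrite eq_complex/= addr0 !eqxx.
Qed.

Lemma real_complexX (r : R) m : (r%:C) ^+ m = (r ^+ m)%:C.
Proof.
elim: m => [//|m IH]; rewrite !exprS IH.
by apply/eqP; rewrite eq_complex/=; apply/andP; split; apply/eqP; ring.
Qed.

Lemma cpow_nat (t : R) m : 0 < t -> cpow t m%:R = (t ^+ m)%:C.
Proof.
move=> t0; rewrite natr_real_complex cpow_realE; congr (_%:C).
by rewrite -[in RHS](@lnK _ t) ?posrE// -expRM_natl mulrC.
Qed.

Lemma cpow_prod n (t : 'I_n -> R) z : (forall i, 0 < t i) ->
  cpow (\prod_i t i) z = \prod_i cpow (t i) z.
Proof.
elim: n t => [|n IH] t t0; first by rewrite !big_ord0 cpow1.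
rewrite !big_ord_recl cpowM//; last by apply: prodr_gt0.
by rewrite IH.
Qed.

End cabs.

Section cintegral_theory.
Context {d : measure_display} {T : measurableType d} {R : realType}.
Variable mu : {measure set T -> \bar R}.
Local Notation C := R[i].
Implicit Types f : T -> C.

Lemma cintegrable_measurable f : cintegrable mu setT f -> cmeasurable f.
Proof.
move=> [/measurable_int mf1 /measurable_int mf2].
by split; apply/measurable_EFinP.
Qed.

Lemma measurable_cabs f : cmeasurable f -> measurable_fun setT (fun x => (cabs (f x))%:E).
Proof. by move=> mf; apply/measurable_EFinP; exact: measurable_Re_norm. Qed.

(** Replaces two signed integrability conditions by the finiteness of one nonnegative integral,
    which Tonelli's theorem can compute. *)
Lemma cintegrableP f :
  cintegrable mu setT f <->
  cmeasurable f /\ (\int[mu]_x (cabs (f x))%:E < +oo)%E.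
Proof.
split=> [if_|[mf iabs]].
  have mf := cintegrable_measurable if_; split => //.
  case: if_ => [/integrableP[m1 i1] /integrableP[m2 i2]].
  apply: (@le_lt_trans _ _ (\int[mu]_x
      (`|(complex.Re (f x))%:E| + `|(complex.Im (f x))%:E|))%E).
    apply: ge0_le_integral => //.
    - by move=> x _; rewrite lee_fin cabs_ge0.
    - exact: measurable_cabs.
    - by apply: emeasurable_funD; exact: measurableT_comp.
    - by move=> x _; rewrite !abse_EFin -EFinD lee_fin cabs_le_ReIm.
  rewrite ge0_integralD//; last 2 first.
  - exact: measurableT_comp.
  - exact: measurableT_comp.
  exact: lte_add_pinfty.
case: (mf) => m1 m2; split; apply/integrableP; split; try exact/measurable_EFinP.
- apply: le_lt_trans iabs; apply: ge0_le_integral => //.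
  + by apply: measurableT_comp => //; exact/measurable_EFinP.
  + exact: measurable_cabs.
  + by move=> x _; rewrite abse_EFin lee_fin Re_le_cabs.
- apply: le_lt_trans iabs; apply: ge0_le_integral => //.
  + by apply: measurableT_comp => //; exact/measurable_EFinP.
  + exact: measurable_cabs.
  + by move=> x _; rewrite abse_EFin lee_fin Im_le_cabs.
Qed.

Lemma cintegralZl (c : C) f : cintegrable mu setT f ->
  cintegrable mu setT (fun x => c * f x) /\
  cintegral mu setT (fun x => c * f x) = c * cintegral mu setT f.
Proof.
case: c => a b [i1 i2].
have E1 : (fun x => complex.Re ((a +i* b) * f x)) =
    (fun x => a * complex.Re (f x) - b * complex.Im (f x)).
  by apply/funext => x; case: (f x).
have E2 : (fun x => complex.Im ((a +i* b) * f x)) =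
    (fun x => a * complex.Im (f x) + b * complex.Re (f x)).
  by apply/funext => x; case: (f x).
have iz (k : R) (g : T -> R) : mu.-integrable setT (EFin \o g) ->
    mu.-integrable setT (EFin \o (fun x => k * g x)).
  move=> ig; rewrite (_ : _ \o _ = fun x => (k%:E * (g x)%:E)%E)//.
  exact: integrableZl.
have iD (g h : T -> R) : mu.-integrable setT (EFin \o g) ->
    mu.-integrable setT (EFin \o h) ->
    mu.-integrable setT (EFin \o (fun x => g x + h x)).
  move=> ig ih; rewrite (_ : _ \o _ = (fun x => (g x)%:E + (h x)%:E)%E)//.
  exact: integrableD.
have iB (g h : T -> R) : mu.-integrable setT (EFin \o g) ->
    mu.-integrable setT (EFin \o h) ->
    mu.-integrable setT (EFin \o (fun x => g x - h x)).
  move=> ig ih; rewrite (_ : _ \o _ = (fun x => (g x)%:E - (h x)%:E)%E)//.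
  exact: integrableB.
split.
  split.
    rewrite (_ : (fun x => _) =
        EFin \o (fun x => a * complex.Re (f x) - b * complex.Im (f x))).
      by apply: iB; exact: iz.
    by rewrite -E1.
  rewrite (_ : (fun x => _) =
      EFin \o (fun x => a * complex.Im (f x) + b * complex.Re (f x))).
    by apply: iD; exact: iz.
  by rewrite -E2.
rewrite /cintegral E1 E2 RintegralB//; [|exact: iz|exact: iz].
rewrite RintegralD//; [|exact: iz|exact: iz].
by rewrite !RintegralZl.
Qed.

(** Extension by zero, so that every complex integral is taken over [setT]. *)
Definition cindic (D : set T) f x : C := (\1_D x)%:C * f x.

Lemma cindicE (D : set T) f x : cindic D f x = if x \in D then f x else 0.
Proof.
rewrite /cindic indicE; case: (x \in D); first by rewrite -[_%:C]/(1 : C) mul1r.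
by rewrite -[_%:C]/(0 : C) mul0r.
Qed.

Lemma Re_cindic (D : set T) f :
  (fun x => complex.Re (cindic D f x)) = (fun x => complex.Re (f x)) \_ D.
Proof. by apply/funext => x; rewrite cindicE patchE; case: ifP. Qed.

Lemma Im_cindic (D : set T) f :
  (fun x => complex.Im (cindic D f x)) = (fun x => complex.Im (f x)) \_ D.
Proof. by apply/funext => x; rewrite cindicE patchE; case: ifP. Qed.

Lemma cintegral_mkcond (D : set T) f :
  cintegral mu D f = cintegral mu setT (cindic D f).
Proof. by rewrite /cintegral Re_cindic Im_cindic -!Rintegral_mkcond. Qed.

Lemma cintegrable_mkcond (D : set T) f : measurable D ->
  cintegrable mu D f <-> cintegrable mu setT (cindic D f).
Proof.
move=> mD; rewrite /cintegrable.
have -> : (fun x => (complex.Re (cindic D f x))%:E) = (fun x => (complex.Re (f x))%:E) \_ D.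
  by apply/funext => x; rewrite cindicE patchE; case: ifP.
have -> : (fun x => (complex.Im (cindic D f x))%:E) = (fun x => (complex.Im (f x))%:E) \_ D.
  by apply/funext => x; rewrite cindicE patchE; case: ifP.
by split=> -[i1 i2]; split; apply/(integrable_mkcond _ mD).
Qed.

End cintegral_theory.

(** * Fubini's theorem for complex functions *)

Section cfubini.
Context {d1 d2 : measure_display} {X : measurableType d1} {Y : measurableType d2}
  {R : realType}.
Variables (mu : {sigma_finite_measure set X -> \bar R})
  (nu : {sigma_finite_measure set Y -> \bar R}).
Local Notation C := R[i].

(** [Rintegral] sends infinite values to 0. Integrability of every section, not just of almost every
    one, makes the real inner integral equal to the extended one at every point. *)
Lemma Rintegral12_prod (f : X -> Y -> R) :
  (mu \x nu)%E.-integrable setT (fun v => (f v.1 v.2)%:E) ->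
  (forall x, nu.-integrable setT (fun y => (f x y)%:E)) ->
  mu.-integrable setT (fun x => (\int[nu]_y f x y)%:E) /\
  \int[mu]_x \int[nu]_y f x y = \int[(mu \x nu)%E]_v f v.1 v.2.
Proof.
move=> if_ ix.
have FE : (fun x => (\int[nu]_y f x y)%:E) = fubini_F nu (fun v : X * Y => (f v.1 v.2)%:E).
  apply/funext => x; rewrite /fubini_F /Rintegral fineK//.
  exact: (integrable_fin_num measurableT (ix x)).
split; first by rewrite FE; exact: integrable_fubini_F.
by rewrite /Rintegral -(integral12_prod_meas1 if_) -FE.
Qed.

Lemma Rintegral21_prod (f : X -> Y -> R) :
  (mu \x nu)%E.-integrable setT (fun v => (f v.1 v.2)%:E) ->
  (forall y, mu.-integrable setT (fun x => (f x y)%:E)) ->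
  \int[nu]_y \int[mu]_x f x y = \int[(mu \x nu)%E]_v f v.1 v.2.
Proof.
move=> if_ iy.
have FE : (fun y => (\int[mu]_x f x y)%:E) = fubini_G mu (fun v : X * Y => (f v.1 v.2)%:E).
  apply/funext => y; rewrite /fubini_G /Rintegral fineK//.
  exact: (integrable_fin_num measurableT (iy y)).
by rewrite /Rintegral -(integral21_prod_meas1 if_) -FE.
Qed.

Lemma cintegrable_prod (f : X -> Y -> C) :
  cmeasurable (fun v : X * Y => f v.1 v.2) ->
  (\int[nu]_y \int[mu]_x (cabs (f x y))%:E < +oo)%E ->
  cintegrable (mu \x nu)%E setT (fun v => f v.1 v.2).
Proof.
move=> mf iabs; apply/cintegrableP; split => //.
rewrite (fubini_tonelli2 (fun v => (cabs (f v.1 v.2))%:E))//.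
- exact: measurable_cabs.
- by move=> v; rewrite lee_fin cabs_ge0.
Qed.

Lemma cintegral12_prod (f : X -> Y -> C) :
  cintegrable (mu \x nu)%E setT (fun v => f v.1 v.2) ->
  (forall x, cintegrable nu setT (f x)) ->
  cintegrable mu setT (fun x => cintegral nu setT (f x)) /\
  cintegral mu setT (fun x => cintegral nu setT (f x)) =
  cintegral (mu \x nu)%E setT (fun v => f v.1 v.2).
Proof.
move=> [i1 i2] ix.
have [I1 E1] := Rintegral12_prod i1 (fun x => proj1 (ix x)).
have [I2 E2] := Rintegral12_prod i2 (fun x => proj2 (ix x)).
by split; [split|rewrite /cintegral E1 E2].
Qed.

Lemma cintegral21_prod (f : X -> Y -> C) :
  cintegrable (mu \x nu)%E setT (fun v => f v.1 v.2) ->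
  (forall y, cintegrable mu setT (f ^~ y)) ->
  cintegral nu setT (fun y => cintegral mu setT (f ^~ y)) =
  cintegral (mu \x nu)%E setT (fun v => f v.1 v.2).
Proof.
move=> [i1 i2] iy.
have E1 := Rintegral21_prod i1 (fun y => proj1 (iy y)).
have E2 := Rintegral21_prod i2 (fun y => proj2 (iy y)).
by rewrite /cintegral E1 E2.
Qed.

End cfubini.

Lemma cmeasurable_comp d d' (X : measurableType d') (T : measurableType d)
    (R : realType) (f : T -> R[i]) (g : X -> T) :
  cmeasurable f -> measurable_fun setT g -> cmeasurable (fun x => f (g x)).
Proof.
move=> [m1 m2] mg.
by split; [exact: (measurableT_comp m1)|exact: (measurableT_comp m2)].
Qed.

(** * Integrals of products of functions of one coordinate *)

Section product.
Context {d : measure_display} {T : measurableType d} {R : realType}.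
Local Notation C := R[i].

Lemma cintegral_cons_measure (mu : {sigma_finite_measure set T -> \bar R}) n
    (nu : {sigma_finite_measure set (n.-tuple T) -> \bar R})
    (F : n.+1.-tuple T -> C) :
  cmeasurable F ->
  cintegrable (mu \x nu)%E setT (fun v => F (tuple_cons (v.1, v.2))) ->
  cintegrable (cons_measure mu nu) setT F /\
  cintegral (cons_measure mu nu) setT F =
  cintegral (mu \x nu)%E setT (fun v => F (tuple_cons (v.1, v.2))).
Proof.
move=> [m1 m2] [i1 i2].
have tE : (fun v : T * n.-tuple T => tuple_cons (v.1, v.2)) = @tuple_cons _ T n.
  by apply/funext => -[].
have key (h : n.+1.-tuple T -> R) : measurable_fun setT h ->
    (mu \x nu)%E.-integrable setT (fun v => (h (tuple_cons (v.1, v.2)))%:E) ->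
    (cons_measure mu nu).-integrable setT (fun w => (h w)%:E) /\
    \int[cons_measure mu nu]_w h w = \int[(mu \x nu)%E]_v h (tuple_cons (v.1, v.2)).
  move=> mh ih.
  have ih' : (mu \x nu)%E.-integrable (@tuple_cons _ T n @^-1` setT)
      ((fun w => (h w)%:E) \o @tuple_cons _ T n).
    by rewrite preimage_setT; apply: eq_integrable ih => // v _; case: v.
  split.
    apply: (integrable_pushforward (measurable_tuple_cons (n := n))) => //.
    exact/measurable_EFinP.
  rewrite /Rintegral (integral_pushforward (measurable_tuple_cons (n := n)) _ ih')//;
    exact/measurable_EFinP.
have [I1 E1] := key _ m1 i1.
have [I2 E2] := key _ m2 i2.
by split; [split|rewrite /cintegral E1 E2].
Qed.

(** The modulus of a product factors, so Tonelli gives integrability on the product space, and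
    Fubini then gives the value. *)
Lemma cintegral_prod (mu : {sigma_finite_measure set T -> \bar R}) n
    (f : 'I_n -> T -> C) :
  (forall i, cintegrable mu setT (f i)) ->
  cintegrable (power_measure mu n) setT (fun w => \prod_i f i (tnth w i)) /\
  cintegral (power_measure mu n) setT (fun w => \prod_i f i (tnth w i)) =
  \prod_i cintegral mu setT (f i).
Proof.
elim: n f => [|n IH] f if_.
  have -> : (fun w : 0.-tuple T => \prod_(i < 0) f i (tnth w i)) = fun=> 1.
    by apply/funext => w; rewrite big_ord0.
  rewrite big_ord0; split.
    apply/cintegrableP; split; first exact: cmeasurable_cst.
    by rewrite integral_power0 ltry.
  by rewrite /cintegral /Rintegral !integral_power0.
pose G (w : n.-tuple T) := \prod_(i < n) f (lift ord0 i) (tnth w i).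
have [iG EG] := IH (fun i => f (lift ord0 i)) (fun i => if_ (lift ord0 i)).
have FE x (w : n.-tuple T) :
    \prod_i f i (tnth (tuple_cons (x, w)) i) = f ord0 x * G w.
  rewrite big_ord_recl; congr (_ * _).
  by apply: eq_bigr => i _; rewrite /tuple_cons tnthS.
have mf i : cmeasurable (f i) := cintegrable_measurable (if_ i).
have mF : cmeasurable (fun w : n.+1.-tuple T => \prod_i f i (tnth w i)).
  by apply: cmeasurable_prod => i; apply: cmeasurable_comp => //; exact: measurable_tnth.
have mG : cmeasurable G := cintegrable_measurable iG.
have i2 : cintegrable (mu \x power_measure mu n)%E setT (fun v => f ord0 v.1 * G v.2).
  apply: (@cintegrable_prod _ _ _ _ _ _ _ (fun x w => f ord0 x * G w)).
    apply: cmeasurableM; first exact: (cmeasurable_comp (mf ord0) measurable_fst).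
    exact: (cmeasurable_comp mG measurable_snd).
  have [_ fi] := (cintegrableP _ _).1 (if_ ord0).
  have [_ Gi] := (cintegrableP _ _).1 iG.
  under eq_integral => w _.
    under eq_integral do rewrite cabsM mulrC EFinM.
    rewrite ge0_integralZl_EFin//; first over.
    - by move=> x _; rewrite lee_fin cabs_ge0.
    - exact: measurable_cabs.
    - exact: cabs_ge0.
  rewrite ge0_integralZr//.
  - apply: lte_mul_pinfty => //.
    + by apply: integral_ge0 => w _; rewrite lee_fin cabs_ge0.
    + by rewrite ge0_fin_numE//; apply: integral_ge0 => w _; rewrite lee_fin cabs_ge0.
  - exact: measurable_cabs.
  - by move=> w _; rewrite lee_fin cabs_ge0.
  - by apply: integral_ge0 => w _; rewrite lee_fin cabs_ge0.
have [I E] := @cintegral_cons_measure mu n (power_measure mu n) _ mF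
  (eq_ind _ (cintegrable (mu \x power_measure mu n)%E setT) i2 _
    (funext (fun v => esym (FE v.1 v.2)))).
split; first exact: I.
rewrite [LHS]E (_ : (fun v => _) = fun v => f ord0 v.1 * G v.2); last first.
  by apply/funext => v; rewrite FE.
rewrite -(@cintegral12_prod _ _ _ _ _ _ _ (fun x w => f ord0 x * G w) i2 _).2; last first.
  by move=> x; exact: (cintegralZl _ iG).1.
under [in LHS]eq_fun do rewrite (cintegralZl _ iG).2 mulrC.
by rewrite (cintegralZl _ (if_ ord0)).2 EG big_ord_recl mulrC.
Qed.

End product.

(** * The matrix-variate gamma integral *)

Section complex_wishart.
Context {R : realType}.
Local Notation C := R[i].
Local Notation T := (measurableTypeR R).
Local Notation L := (@lebesgue_measure R).
Local Notation P := (power_measure L).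
Local Notation H := (@hermmx_lebesgue R).

Lemma real_complexM (r s : R) : (r * s)%:C = r%:C * s%:C.
Proof. by apply/eqP; rewrite eq_complex/= !(mulr0, mul0r, subr0, addr0) !eqxx. Qed.

Lemma real_complex_prod n (F : 'I_n -> R) : (\prod_i F i)%:C = \prod_i (F i)%:C.
Proof. exact: (big_morph (fun r : R => r%:C) real_complexM erefl). Qed.

Definition gamma_integrand (z : C) (t : R) : C := cpow t (z - 1) * (expR (- t))%:C.

Lemma cintegrable_gamma (z : C) : 0 < complex.Re z ->
  cintegrable L `]0, +oo[ (gamma_integrand z).
Proof.
move=> z0; apply/cintegrable_mkcond => //; apply/cintegrableP; split.
  apply: cmeasurableM.
    by apply: cmeasurable_real; apply: measurable_indic; exact: measurable_itv.
  apply: cmeasurableM; first exact: cmeasurable_cpow.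
  apply: cmeasurable_real; apply: (measurableT_comp (@measurable_expR R)).
  exact: measurable_funN.
rewrite (_ : (fun _ => _) =
    (fun t => (gamma_fun (complex.Re z) t)%:E) \_ `]0, +oo[); last first.
  apply/funext => t; rewrite cindicE patchE; case: ifPn => [|_]; last first.
    by rewrite /cabs normr0.
  rewrite inE/= in_itv/= andbT => t0.
  rewrite cabsM cabs_cpow cabs_real ger0_norm ?expR_ge0// /gamma_fun /powR gt_eqF//.
  by case: (z) => a b.
rewrite -integral_mkcond; exact: integral_gamma_fun_lty.
Qed.

Lemma measurable_wishart_arg n (A : 'M[C]_n) (h : R -> R) : measurable_fun setT h ->
  measurable_fun setT (fun t : n.-tuple T => bartlett_density t * h (tuple_prod t / absdet A)).
Proof.
move=> mh; apply: measurable_funM; first exact: measurable_bartlett_density.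
apply: (measurableT_comp mh); apply: measurable_funM; last exact: measurable_cst.
exact: measurable_tuple_prod.
Qed.

(** Extends the law to signed [h] by positive and negative parts. Both are bounded by |h|, so their
    integrals are finite and may be subtracted. *)
Lemma wishart_law_integrable n (A : 'M[C]_n) (h : R -> R) : posdefmx A ->
  measurable_fun setT h ->
  (P n).-integrable setT
    (fun t => (bartlett_density t * h (tuple_prod t / absdet A))%:E) ->
  (H n).-integrable setT (fun w => (wishart A h w)%:E) /\
  \int[H n]_w wishart A h w =
    (absdet A) ^- n * \int[P n]_t (bartlett_density t * h (tuple_prod t / absdet A)).
Proof.
move=> pA mh ig.
have d0 : 0 < absdet A by exact: absdet_gt0.
have dn0 : 0 <= absdet A ^- n by rewrite invr_ge0 exprn_ge0// ltW.
have pos (e : R -> R) : measurable_fun setT e -> (forall r, 0 <= e r) ->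
    (forall r, e r <= `|h r|) ->
    [/\ (P n).-integrable setT
          (fun t => (bartlett_density t * e (tuple_prod t / absdet A))%:E),
        (H n).-integrable setT (fun w => (wishart A e w)%:E) &
        \int[H n]_w wishart A e w =
          (absdet A) ^- n * \int[P n]_t (bartlett_density t * e (tuple_prod t / absdet A))].
  move=> me e0 eh.
  have ie : (P n).-integrable setT
      (fun t => (bartlett_density t * e (tuple_prod t / absdet A))%:E).
    apply: le_integrable ig => //.
      by apply/measurable_EFinP; exact: measurable_wishart_arg.
    move=> t _; rewrite !abse_EFin lee_fin !normrM ler_wpM2l// ger0_norm//.
  have law := wishart_law pA me e0.
  have fin := integrable_fin_num measurableT ie.
  split => //; last by rewrite /Rintegral law fineM.
  apply/integrableP; split.
    by apply/measurable_EFinP; apply: measurable_wishart => //; exact: mxmeasurable_cst.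
  under eq_integral do rewrite gee0_abs ?lee_fin ?wishart_ge0//.
  by rewrite law ltey_eq fin_numM.
pose hp r := Num.max (h r) 0; pose hn r := Num.max (- h r) 0.
have hE r : h r = hp r - hn r.
  by rewrite /hp /hn; case: (leP (h r) 0) => hr; case: (leP (- h r) 0) => hr'; lra.
have [||| ip iwp Ep] := pos hp.
- by apply: measurable_maxr => //; exact: measurable_cst.
- by move=> r; rewrite /hp le_max lexx orbT.
- by move=> r; rewrite /hp ge_max ler_norm normr_ge0.
have [||| i_n iwn En] := pos hn.
- by apply: measurable_maxr; [exact: measurable_funN|exact: measurable_cst].
- by move=> r; rewrite /hn le_max lexx orbT.
- by move=> r; rewrite /hn ge_max -normrN ler_norm normr_ge0.
have wE : wishart A h = fun w => wishart A hp w - wishart A hn w.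
  by apply/funext => w; rewrite /wishart hE; ring.
have bE : (fun t : n.-tuple T => bartlett_density t * h (tuple_prod t / absdet A)) =
    fun t => bartlett_density t * hp (tuple_prod t / absdet A) -
             bartlett_density t * hn (tuple_prod t / absdet A).
  by apply/funext => t; rewrite hE; ring.
split; first by rewrite wE; exact: (integrableB _ iwp iwn).
by rewrite wE bE !RintegralB// Ep En mulrBr.
Qed.

Definition cwishart n (z : C) (A : 'M[C]_n) : n.-tuple (n.-tuple T) -> C :=
  cindic (@posdef_set R n) (fun w =>
    cpow (absdet (hermmx w)) (z - n%:R) * (expR (- rtrace A (hermmx w)))%:C).

Lemma ImZ (r : R) (z : C) : complex.Im (r%:C * z) = r * complex.Im z.
Proof. by case: z => a b /=; ring. Qed.

Lemma Re_cwishart n z (A : 'M[C]_n) w :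
  complex.Re (cwishart z A w) = wishart A (fun r => complex.Re (cpow r (z - n%:R))) w.
Proof. by rewrite /cwishart /cindic ReZ mulrC (mulrC (cpow _ _)) ReZ /wishart; ring. Qed.

Lemma Im_cwishart n z (A : 'M[C]_n) w :
  complex.Im (cwishart z A w) = wishart A (fun r => complex.Im (cpow r (z - n%:R))) w.
Proof. by rewrite /cwishart /cindic ImZ mulrC (mulrC (cpow _ _)) ImZ /wishart; ring. Qed.

Definition cbartlett n (z : C) (A : 'M[C]_n) (t : n.-tuple T) : C :=
  (bartlett_density t)%:C * cpow (tuple_prod t / absdet A) (z - n%:R).

Lemma cwishart_law n (z : C) (A : 'M[C]_n) : posdefmx A ->
  cintegrable (P n) setT (cbartlett z A) ->
  cintegrable (H n) setT (cwishart z A) /\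
  cintegral (H n) setT (cwishart z A) =
    ((absdet A) ^- n)%:C * cintegral (P n) setT (cbartlett z A).
Proof.
move=> pA [i1 i2]; set f := cbartlett z A in i1 i2 *.
have [m1 m2] : cmeasurable (fun r : R => cpow r (z - n%:R)) by exact: cmeasurable_cpow.
have E1 : (fun t => complex.Re (f t)) = fun t =>
    bartlett_density t * complex.Re (cpow (tuple_prod t / absdet A) (z - n%:R)).
  by apply/funext => t; rewrite ReZ.
have E2 : (fun t => complex.Im (f t)) = fun t =>
    bartlett_density t * complex.Im (cpow (tuple_prod t / absdet A) (z - n%:R)).
  by apply/funext => t; rewrite ImZ.
have [I1 J1] := @wishart_law_integrable n A (fun r => complex.Re (cpow r (z - n%:R))) pA m1
  (eq_ind _ (fun g => (P n).-integrable setT (EFin \o g)) i1 _ E1).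
have [I2 J2] := @wishart_law_integrable n A (fun r => complex.Im (cpow r (z - n%:R))) pA m2
  (eq_ind _ (fun g => (P n).-integrable setT (EFin \o g)) i2 _ E2).
split.
  split.
    by under eq_fun do rewrite Re_cwishart.
  by under eq_fun do rewrite Im_cwishart.
rewrite /cintegral E1 E2.
under [in LHS]eq_Rintegral do rewrite Re_cwishart.
under [X in _ +i* X]eq_Rintegral do rewrite Im_cwishart.
rewrite J1 J2; apply/eqP; rewrite eq_complex/=.
by apply/andP; split; apply/eqP; ring.
Qed.

Definition gamma_factor m (z : C) (t : T) : C :=
  (pi ^+ m)%:C * @cindic _ T R `]0%R, +oo[ (gamma_integrand z) t.

Lemma cintegral_gamma_factor m z : 0 < complex.Re z ->
  cintegrable L setT (gamma_factor m z) /\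
  cintegral L setT (gamma_factor m z) = (pi ^+ m)%:C * cgamma z.
Proof.
move=> z0; have ig := cintegrable_gamma z0.
have ig' : cintegrable L setT (@cindic _ T R `]0%R, +oo[ (gamma_integrand z)).
  by apply/(cintegrable_mkcond L _ (measurable_itv _)); exact: ig.
have [I E] := cintegralZl (pi ^+ m)%:C ig'.
by split => //; rewrite /gamma_factor E -cintegral_mkcond.
Qed.

(** The power n - i - 1 in the i-th gamma weight and the exponent z - n of the determinant add up to
    (z - i) - 1: this is the source of the arguments z - i in the matrix gamma function. If some
    coordinate is not positive, both sides vanish. *)
Lemma bartlett_factor n (z : C) (A : 'M[C]_n) (t : n.-tuple T) : 0 < absdet A ->
  cbartlett z A t = cpow (absdet A) (n%:R - z) *
    \prod_(i < n) gamma_factor (n - i.+1) (z - i%:R) (tnth t i).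
Proof.
move=> d0; rewrite /cbartlett.
have [t0|] := pselect (forall i, 0 < tnth t i); last first.
  move=> /existsNP[i /negP]; rewrite -leNgt => ti.
  rewrite (_ : bartlett_density t = 0); last first.
    by rewrite /bartlett_density (bigD1 i)//= /gamma_density ltNge ti/= mul0r.
  have g0 : gamma_factor (n - i.+1) (z - i%:R) (tnth t i) = 0.
    rewrite /gamma_factor cindicE memNset ?mulr0//.
    by rewrite /= in_itv/= andbT; apply/negP; rewrite -leNgt.
  by rewrite (bigD1 i)//= g0 !mul0r mulr0.
have tp0 : 0 < tuple_prod t by apply: prodr_gt0.
rewrite cpowM ?invr_gt0// cpowV// opprB mulrA mulrC; congr (_ * _).
rewrite /tuple_prod cpow_prod// /bartlett_density real_complex_prod -big_split/=.
apply: eq_bigr => i _.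
have ti := t0 i.
rewrite /gamma_factor cindicE mem_set; last by rewrite /= in_itv/= andbT.
rewrite /gamma_integrand /gamma_density ti !real_complexM -(cpow_nat _ ti).
have -> : z - i%:R - 1 = (n - i.+1)%:R + (z - n%:R).
  by rewrite natrB// -natr1; ring.
rewrite (cpowD _ (n - i.+1)%:R) -!mulrA.
congr (_ * (_ * _)).
by rewrite mulrC.
Qed.

Lemma prod_exp_pi n : \prod_(i < n) (pi ^+ (n - i.+1))%:C = pi%:C ^+ (n * n.-1)./2 :> C.
Proof.
under eq_bigr do rewrite -real_complexX.
rewrite -[X in _ ^+ X]bin2 -bin2_sum big_mkord (reindex_inj rev_ord_inj)/=.
rewrite -expr_sum; congr (_ ^+ _).
by apply: eq_bigr => i _; rewrite -subSn// subKn//; exact: ltnW.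
Qed.

(** The bound on the real part of [z] makes Euler's integral converge at z - i for every i < n. The
    power |det A|^-n of the law and |det A|^(n - z) from the argument of the determinant combine
    into |det A|^-z. *)
Lemma integral_cwishart n (z : C) (A : 'M[C]_n) : posdefmx A ->
  n%:R - 1 < complex.Re z ->
  cintegrable (H n) setT (cwishart z A) /\
  cintegral (H n) setT (cwishart z A) = matrix_cgamma n z * cpow (absdet A) (- z).
Proof.
move=> pA zn; have d0 := absdet_gt0 pA.
have zi (i : 'I_n) : 0 < complex.Re (z - i%:R).
  rewrite natr_real_complex; case: z zn => a b /=; rewrite subr_gt0 => /(le_lt_trans _); apply.
  by rewrite lerBrDr natr1 ler_nat.
have fi (i : 'I_n) := cintegral_gamma_factor (n - i.+1) (zi i).
have [ip Ep] := cintegral_prod (fun i => (fi i).1).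
have [ib Eb] := cintegralZl (cpow (absdet A) (n%:R - z)) ip.
have bE : cbartlett z A = fun t => cpow (absdet A) (n%:R - z) *
    \prod_(i < n) gamma_factor (n - i.+1) (z - i%:R) (tnth t i).
  by apply/funext => t; rewrite bartlett_factor.
have [I E] : cintegrable (H n) setT (cwishart z A) /\
  cintegral (H n) setT (cwishart z A) =
    ((absdet A) ^- n)%:C * cintegral (P n) setT (cbartlett z A).
  by apply: cwishart_law => //; rewrite bE.
split => //; rewrite E bE Eb Ep.
under eq_bigr do rewrite (fi _).2.
rewrite big_split/= prod_exp_pi /matrix_cgamma -exprVn
  -(cpow_nat _ (_ : 0 < (absdet A)^-1)) ?invr_gt0//.
rewrite cpowV// mulrA -cpowD (_ : - n%:R + (n%:R - z) = - z); last by ring.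
by rewrite mulrC subn1.
Qed.

End complex_wishart.

(** * The type-2 Dirichlet integral *)

Section dirichlet.
Context {R : realType} (p k : nat).
Local Notation C := R[i].
Local Notation T := (measurableTypeR R).
Local Notation H := (@hermmx_lebesgue R p).
Local Notation Hk := (power_measure H k).
Local Notation Hs := (p.-tuple (p.-tuple T)).
Local Notation K := (matrix_cgamma p).
Implicit Types (a : 'I_k -> C) (b s z : C) (Y : Hs) (Z : k.-tuple Hs).

Lemma cmeasurable_cwishart d (X : measurableType d) z (A : X -> 'M[C]_p)
    (w : X -> Hs) : mxmeasurable A -> measurable_fun setT w ->
  cmeasurable (fun x => cwishart z (A x) (w x)).
Proof.
move=> mA mw; apply: cmeasurableM.
  apply: cmeasurable_real; apply: (measurableT_comp _ mw).
  by apply: measurable_indic; exact: measurable_posdefmx.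
apply: cmeasurableM.
  by apply: cmeasurable_cpow; apply: measurable_absdet; exact: mxmeasurable_hermmx.
apply: cmeasurable_real; apply: (measurableT_comp (@measurable_expR R)).
by apply: measurable_funN; apply: measurable_rtrace => //; exact: mxmeasurable_hermmx.
Qed.

Lemma cwishart_notin z A Y : ~ posdefmx (hermmx Y : 'M[C]_p) -> cwishart z A Y = 0.
Proof. by move=> nY; rewrite /cwishart cindicE memNset. Qed.

Lemma cwishart_in z A Y : posdefmx (hermmx Y : 'M[C]_p) -> cwishart z A Y =
  cpow (absdet (hermmx Y)) (z - p%:R) * (expR (- rtrace A (hermmx Y)))%:C.
Proof. by move=> nY; rewrite /cwishart cindicE mem_set. Qed.

Lemma cabs_cwishart z (A : 'M[C]_p) Y :
  (cabs (cwishart z A Y))%:C = cwishart (complex.Re z)%:C A Y.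
Proof.
have [pY|nY] := pselect (posdefmx (hermmx Y : 'M[C]_p)); last first.
  by rewrite !cwishart_notin// /cabs normr0.
rewrite !cwishart_in// cabsM cabs_cpow cabs_real ger0_norm ?expR_ge0//.
rewrite real_complexM; congr (_ * _).
have -> : (complex.Re z)%:C - p%:R = (complex.Re (z - p%:R))%:C.
  rewrite natr_real_complex; case: z => u v.
  by apply/eqP; rewrite eq_complex/= subr0 !eqxx.
by rewrite cpow_realE.
Qed.

(** The function F of the overview, extended by zero outside the cones. Each [tnth Z j] carries the
    exponential weight with parameter [hermmx Y]. *)
Definition joint a s Z Y : C :=
  cwishart s 1%:M Y * \prod_j cwishart (a j) (hermmx Y) (tnth Z j).

(* Absolute integrability is thus reduced to real parameters. *)
Lemma cabs_joint a s Z Y : (cabs (joint a s Z Y))%:C =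
  joint (fun j => (complex.Re (a j))%:C) (complex.Re s)%:C Z Y.
Proof.
rewrite /joint cabsM cabs_prod real_complexM; congr (_ * _).
  exact: cabs_cwishart.
rewrite real_complex_prod; apply: eq_bigr => j _; exact: cabs_cwishart.
Qed.

Lemma cmeasurable_joint a s :
  cmeasurable (fun v : k.-tuple Hs * Hs => joint a s v.1 v.2).
Proof.
apply: cmeasurableM.
  by apply: cmeasurable_cwishart; [exact: mxmeasurable_cst|exact: measurable_snd].
apply: cmeasurable_prod => j; apply: cmeasurable_cwishart; last by meas.
by apply: mxmeasurable_hermmx; exact: measurable_snd.
Qed.

Lemma cintegral_cst0 d (X : measurableType d) (mu : {measure set X -> \bar R}) :
  cintegrable mu setT (fun=> 0 : C) /\ cintegral mu setT (fun=> 0 : C) = 0.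
Proof.
split; first by split; exact: integrable0.
by rewrite /cintegral /Rintegral integral0.
Qed.

(** For fixed positive definite Y the factors are independent gamma integrals, and their powers |det
    Y|^(- a_j) turn [s] into [s - \sum_j a j]. Off the cone everything is 0, so the conclusion holds
    for every section, as Fubini's theorem requires it here. *)
Lemma cintegral_joint_tuple a s Y : (forall j, p%:R - 1 < complex.Re (a j)) ->
  cintegrable Hk setT (joint a s ^~ Y) /\
  cintegral Hk setT (joint a s ^~ Y) =
    (\prod_j K (a j)) * cwishart (s - \sum_j a j) 1%:M Y.
Proof.
move=> ha; have [pY|nY] := pselect (posdefmx (hermmx Y : 'M[C]_p)); last first.
  rewrite (_ : joint a s ^~ Y = fun=> 0); last first.
    by apply/funext => Z; rewrite /joint cwishart_notin// mul0r.
  by rewrite cwishart_notin// mulr0; exact: cintegral_cst0.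
have hj j := integral_cwishart pY (ha j).
have [ip Ep] := cintegral_prod (fun j => (hj j).1).
have [ij Ej] := cintegralZl (cwishart s 1%:M Y) ip.
split; first exact: ij.
rewrite [LHS]Ej Ep; under eq_bigr do rewrite (hj _).2.
rewrite big_split/= mulrCA; congr (_ * _).
rewrite -cpow_sum !cwishart_in// mulrAC -cpowD; congr (cpow _ _ * _).
by rewrite sumrN addrAC.
Qed.

Lemma rtraceC (A B : 'M[C]_p) : rtrace A B = rtrace B A.
Proof. by rewrite /rtrace mxtrace_mulC. Qed.

Lemma rtrace_sum (A : 'M[C]_p) (B : 'I_k -> 'M[C]_p) (D : 'M[C]_p) :
  rtrace (A + \sum_j B j) D = rtrace A D + \sum_j rtrace (B j) D.
Proof.
rewrite /rtrace mulmxDl mxtraceD ReD mulmx_suml; congr (_ + _).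
have h : {morph (fun M : 'M[C]_p => complex.Re (\tr M)) : x y / x + y}.
  by move=> x y; rewrite mxtraceD ReD.
have h0 : complex.Re (\tr (0 : 'M[C]_p)) = 0 by rewrite mxtrace0.
exact: (big_morph _ h h0).
Qed.

Lemma posdefmx_add_sum (A : 'M[C]_p) (B : 'I_k -> 'M[C]_p) : posdefmx A ->
  (forall j, posdefmx (B j)) -> posdefmx (A + \sum_j B j).
Proof.
move=> pA pB; elim/big_rec: _ => [|j M _ IH]; first by rewrite addr0.
by rewrite addrCA; exact: posdefmxD.
Qed.

Definition dirichlet2_kernel a s Z : C :=
  (\prod_j cpow (absdet (hermmx (tnth Z j))) (a j - p%:R)) *
  cpow (absdet (1%:M + \sum_j hermmx (tnth Z j) : 'M[C]_p)) (- s).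

Lemma measurable_dirichlet2_domain : measurable (@dirichlet2_domain R p k).
Proof.
rewrite (_ : @dirichlet2_domain R p k =
  \bigcap_(j in [set: 'I_k]) ((fun Z : k.-tuple Hs => tnth Z j) @^-1` @posdef_set R p)).
  apply: fin_bigcap_measurable => [|j _]; first exact: finite_finset.
  by rewrite -[X in measurable X]setTI; apply: measurable_tnth => //;
    exact: measurable_posdefmx.
by apply/seteqP; split => [Z h j _|Z h j]; [exact: h|exact: (h j I)].
Qed.

(** As tr Y + sum_j tr (Y Z_j) = tr ((I + sum_j Z_j) Y), the integral over Y is a single gamma
    integral with parameter I + sum_j Z_j. *)
Lemma cintegral_joint_matrix a s Z : p%:R - 1 < complex.Re s ->
  cintegrable H setT (joint a s Z) /\
  cintegral H setT (joint a s Z) =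
    K s * cindic (@dirichlet2_domain R p k) (dirichlet2_kernel a s) Z.
Proof.
move=> hs; rewrite cindicE; case: ifPn => [|]; rewrite ?inE ?notin_setE => hZ; last first.
  have -> : joint a s Z = fun=> 0.
    apply/funext => Y; rewrite /joint; have /existsNP[j nj] := hZ.
    by rewrite (bigD1 j)//= (cwishart_notin _ _ nj) mul0r mulr0.
  by rewrite mulr0; exact: cintegral_cst0.
have pA := posdefmx_add_sum (@posdefmx1 R p) hZ.
have [iw Ew] := integral_cwishart pA hs.
have [I E] := cintegralZl (\prod_j cpow (absdet (hermmx (tnth Z j))) (a j - p%:R)) iw.
have -> : joint a s Z = fun Y =>
    (\prod_j cpow (absdet (hermmx (tnth Z j))) (a j - p%:R)) *
    cwishart s (1%:M + \sum_j hermmx_family Z j) Y.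
  apply/funext => Y; rewrite /joint.
  have [pY|nY] := pselect (posdefmx (hermmx Y : 'M[C]_p)); last first.
    by rewrite !(cwishart_notin _ _ nY) mul0r mulr0.
  under eq_bigr do rewrite (cwishart_in _ _ (hZ _)).
  rewrite big_split/= !(cwishart_in _ _ pY) rtrace_sum opprD expRD real_complexM.
  rewrite -real_complex_prod -expR_sum -sumrN.
  have -> : \sum_j - rtrace (hermmx Y) (hermmx (tnth Z j)) =
      \sum_j - rtrace (hermmx_family Z j) (hermmx Y).
    by apply: eq_bigr => j _; rewrite rtraceC.
  by rewrite mulrCA -!mulrA.
split; first exact: I.
by rewrite E Ew /dirichlet2_kernel mulrCA.
Qed.

Lemma ReB (z w : C) : complex.Re (z - w) = complex.Re z - complex.Re w.
Proof. by case: z w => [u v] [u' v']. Qed.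

Lemma Re_sum (F : 'I_k -> C) : complex.Re (\sum_j F j) = \sum_j complex.Re (F j).
Proof. exact: (big_morph _ (@ReD R) erefl). Qed.

Lemma dirichlet2_integral a b (s := \sum_j a j + b) :
  (forall j, p%:R - 1 < complex.Re (a j)) -> p%:R - 1 < complex.Re b ->
  p%:R - 1 < complex.Re s ->
  cintegrable Hk setT
    (fun Z => K s * cindic (@dirichlet2_domain R p k) (dirichlet2_kernel a s) Z) /\
  cintegral Hk setT
    (fun Z => K s * cindic (@dirichlet2_domain R p k) (dirichlet2_kernel a s) Z) =
  (\prod_j K (a j)) * K b.
Proof.
move=> ha hb hs.
have bE : s - \sum_j a j = b by rewrite /s addrC addKr.
have ij : cintegrable (Hk \x H)%E setT (fun v => joint a s v.1 v.2).
  apply: cintegrable_prod; first exact: cmeasurable_joint.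
  (* The modulus of the integrand is the same integrand at the real parts [ar] and [sr]. Its
     integral over Z is known, and what is left in Y is a gamma integral at sr - sum_j ar_j, that
     is, at the real part of [b]. *)
  pose ar j : C := (complex.Re (a j))%:C; pose sr : C := (complex.Re s)%:C.
  have har j : p%:R - 1 < complex.Re (ar j) by exact: ha.
  have hbr : p%:R - 1 < complex.Re (sr - \sum_j ar j).
    rewrite ReB /sr/= Re_sum (eq_bigr (fun j => complex.Re (a j)))// -Re_sum -ReB.
    by rewrite bE.
  have [ib _] := cintegralZl (\prod_j K (ar j))
    (integral_cwishart (@posdefmx1 R p) hbr).1.
  rewrite (_ : (fun Y => _) = fun Y => (complex.Re ((\prod_j K (ar j)) *
      cwishart (sr - \sum_j ar j) 1%:M Y))%:E).
    by apply: integrable_lty => //; exact: ib.1.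
  apply/funext => Y; have [iY EY] := cintegral_joint_tuple sr Y har.
  rewrite -EY /cintegral/= /Rintegral fineK; last exact: (integrable_fin_num _ iY.1).
  by apply: eq_integral => Z _; rewrite -cabs_joint.
have [I E] := cintegral12_prod ij (fun Z => (cintegral_joint_matrix a Z hs).1).
have fE : (fun Z => cintegral H setT (joint a s Z)) =
   (fun Z => K s * cindic (@dirichlet2_domain R p k) (dirichlet2_kernel a s) Z).
  by apply/funext => Z; exact: (cintegral_joint_matrix a Z hs).2.
rewrite -fE; split => //; rewrite E.
rewrite -(cintegral21_prod ij (fun Y => (cintegral_joint_tuple s Y ha).1)).
under eq_fun do rewrite (cintegral_joint_tuple s _ ha).2.
have [ib Eb] := integral_cwishart (@posdefmx1 R p) hb.
rewrite bE (cintegralZl _ ib).2 Eb.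
by rewrite /absdet det1 normr1 cpow1 mulr1.
Qed.

End dirichlet.

(** * The moments of the determinants *)

Theorem mainTheorem4 (R : realType) (p k : nat)
    (a : 'I_k -> R[i]) (b : R[i]) (g : 'I_k -> R[i]) :
  (1 <= p)%N -> (1 <= k)%N ->
  (forall j, p%:R - 1 < complex.Re (a j)) ->
  p%:R - 1 < complex.Re b ->
  (forall j, p%:R - 1 < complex.Re (a j + g j)) ->
  p%:R - 1 < complex.Re (b - \sum_j g j) ->
  dirichlet2_average_exists a b (@phi4 R p k g) /\
  dirichlet2_average a b (@phi4 R p k g) =
    (\prod_j (matrix_cgamma p (a j + g j) / matrix_cgamma p (a j))) *
    (matrix_cgamma p (b - \sum_j g j) / matrix_cgamma p b).
Proof.
move=> p1 _ ha hb hag hbg.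
pose ag j := a j + g j; pose bg := b - \sum_j g j.
pose s := \sum_j a j + b.
(* The shifts cancel in the total. So [phi4] times the density is, up to its constant, the Dirichlet
   kernel with parameters [ag] and [bg] and the same exponent [s] of |det (I + sum_j X_j)|. *)
have sE : \sum_j ag j + bg = s by rewrite /ag /bg /s big_split/=; ring.
(* As 1 <= p, the real parts of the [a j] are nonnegative, so adding them to [b] preserves the lower
   bound. *)
have hs : p%:R - 1 < complex.Re s.
  rewrite /s ReD Re_sum ltr_wpDl// sumr_ge0// => j _.
  by apply/ltW/(le_lt_trans _ (ha j)); rewrite subr_ge0 ler1n.
have [I E] := dirichlet2_integral hag hbg (eq_ind_r (fun s => p%:R - 1 < complex.Re s) hs sE).
rewrite sE in I E.
(* The normalizing constant is Gamma_p(s) / den; its numerator is already a factor of the integral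
   just computed, so only the inverse of [den] is pulled out. *)
pose den := (\prod_j matrix_cgamma p (a j)) * matrix_cgamma p b.
have [I' E'] := cintegralZl den^-1 I.
have FE : cindic (@dirichlet2_domain R p k) (fun w =>
    phi4 g (hermmx_family w) * dirichlet2_density a b (hermmx_family w)) =
  (fun w => den^-1 * (matrix_cgamma p s *
    cindic (@dirichlet2_domain R p k) (dirichlet2_kernel ag s) w)).
  apply/funext => w; rewrite !cindicE; case: ifP => _; last by rewrite !mulr0.
  rewrite /phi4 /dirichlet2_density /dirichlet2_const /dirichlet2_kernel -/s -/den.
  rewrite /hermmx_family.
  have -> : \prod_j cpow (absdet (hermmx (tnth w j))) (ag j - p%:R) =
      (\prod_j cpow (absdet (hermmx (tnth w j))) (g j)) *
      \prod_j cpow (absdet (hermmx (tnth w j))) (a j - p%:R).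
    rewrite -big_split/=; apply: eq_bigr => j _; rewrite -cpowD; congr cpow.
    by rewrite /ag; ring.
  by ring.
split.
  apply: (cintegrable_mkcond (power_measure (@hermmx_lebesgue R p) k) _
    (@measurable_dirichlet2_domain R p k)).2.
  exact: (eq_ind_r (cintegrable _ setT) I' FE).
have -> : dirichlet2_average a b (@phi4 R p k g) =
    cintegral (power_measure (@hermmx_lebesgue R p) k) setT (fun w => den^-1 *
      (matrix_cgamma p s *
       cindic (@dirichlet2_domain R p k) (dirichlet2_kernel ag s) w)).
  by rewrite -FE; exact: cintegral_mkcond.
rewrite E' E.
by rewrite prodf_div /den invfM mulrACA; congr (_ * _); rewrite mulrC.
Qed.
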